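(* Let $a>1$, $x\in\mathbb{R}$ being fixed, and let $g\in L^2(\mathbb{R})$ with $g\neq0$. Then the superoscillating sequence $F_n(y,a)$ satisfies the following integral representation $$F_n(y,a)=\frac{1}{g(y-x)\,\|g\|^2_{L^2(\mathbb{R})}}\int_{\mathbb{R}^2}\varphi_n(u,\eta)\,(M_\eta T_ug)(y)\,du\,d\eta$$ for every $y\in\mathbb{R}$, where $$\varphi_n(u,\eta)=\sum_{j=0}^nC_j(n,a)K_g(x,\omega_j;u,\eta),\qquad \omega_j=1-\frac{2j}{n}.$$
   Context: $(T_xf)(t)=f(t-x)$ and $(M_\omega f)(t)=e^{i\omega t}f(t)$. The inner product is $\langle f,h\rangle_{L^2(\mathbb{R})}=\int_{\mathbb{R}}f(t)\overline{h(t)}\,dt$. The Gabor kernel is $K_g(x,\omega;u,\eta)=\langle M_\omega T_xg,M_\eta T_ug\rangle_{L^2(\mathbb{R})}$. The superoscillating sequence, $n\in\mathbb{N}$, is $F_n(t,a)=\sum_{j=0}^nC_j(n,a)e^{i(1-2j/n)t}$ with $C_j(n,a)=\binom{n}{j}\left(\frac{1+a}{2}\right)^{n-j}\left(\frac{1-a}{2}\right)^j$.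
   Formalization: A missing factor 1/(2π) is added; n ≥ 1; the formula is stated for every y with g(y-x) ≠ 0, y-x a Lebesgue point of g and the integral absolutely convergent, and, with the integral read weakly in L², for almost every y with g(y-x) ≠ 0. *)

(* Defs.v *)
From HB Require Import structures.
From mathcomp Require Import all_boot all_order all_algebra.
From mathcomp Require Import all_classical all_reals all_analysis.
From mathcomp Require Import complex.

Set Implicit Arguments.
Unset Strict Implicit.
Unset Printing Implicit Defensive.

Import Order.TTheory GRing.Theory Num.Theory.
Import numFieldNormedType.Exports.

Local Open Scope classical_set_scope.
Local Open Scope ring_scope.
Local Open Scope complex_scope.

(* R[i] carries no measurable structure in the library, so complex
   measurability and integration are componentwise. *)
Definition Cintegrable d (T : measurableType d) (R : realType)
    (mu : {measure set T -> \bar R}) (f : T -> R[i]) : Prop :=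
  mu.-integrable setT (EFin \o (fun t => complex.Re (f t))) /\
  mu.-integrable setT (EFin \o (fun t => complex.Im (f t))).

Definition Cintegral d (T : measurableType d) (R : realType)
    (mu : {measure set T -> \bar R}) (f : T -> R[i]) : R[i] :=
  Complex (Rintegral mu setT (fun t => complex.Re (f t)))
          (Rintegral mu setT (fun t => complex.Im (f t))).

Section GaborSuperoscillation.
Context {R : realType}.
Implicit Types (f g h : R -> R[i]) (a t x y u w eta : R) (n j : nat).

Notation mu1 := (@lebesgue_measure R).

(* du deta: plain planar Lebesgue measure, without a factor 1/(2 pi) *)
Definition mu2 := (mu1 \x mu1)%E.

(* Borel representatives of the classes in L^2(R; C) *)
Definition L2 f : Prop :=
  [/\ measurable_fun setT (fun t => complex.Re (f t)),
      measurable_fun setT (fun t => complex.Im (f t)) &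
      finite_norm mu1 2%:E (fun t => ComplexField.Normc.normc (f t))].

Definition L2norm f : R :=
  fine ('N[mu1]_(2%:E)[EFin \o (fun t => ComplexField.Normc.normc (f t))])%E.

Definition inner f h : R[i] := Cintegral mu1 (fun t => f t * conjc (h t)).

Definition expi t : R[i] := Complex (cos t) (sin t).

Definition translation x f : R -> R[i] := fun t => f (t - x).

Definition modulation w f : R -> R[i] := fun t => expi (w * t) * f t.

Definition gabor_atom g (p : R * R) : R -> R[i] :=
  modulation p.2 (translation p.1 g).

Definition gabor_kernel g x w u eta : R[i] :=
  inner (gabor_atom g (x, w)) (gabor_atom g (u, eta)).

Definition freq n j : R := 1 - 2 * j%:R / n%:R.

Definition coefC n a j : R :=
  ('C(n, j))%:R * ((1 + a) / 2) ^+ (n - j) * ((1 - a) / 2) ^+ j.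

Definition superosc n t a : R[i] :=
  \sum_(j < n.+1) real_complex R (coefC n a j) * expi (freq n j * t).

Definition phi n a x g (p : R * R) : R[i] :=
  \sum_(j < n.+1)
    real_complex R (coefC n a j) * gabor_kernel g x (freq n j) p.1 p.2.

(* Both components of f have a Lebesgue point at t. This holds for almost every
   t when f is in L2, and at every point of continuity of f; at such a point
   the value f t is determined by the averages of f. *)
Definition Clebesgue_pt f t : Prop :=
  lebesgue_pt (fun s => complex.Re (f s)) t /\
  lebesgue_pt (fun s => complex.Im (f s)) t.

(* Phi is (a representative of) the L^2-valued weak integral of
   p |-> w p *: v p over the plane. The pointwise integrals
   \int w p * v p y dp need not converge absolutely for a Gabor system whose
   window is only in L^2, whereas this one always exists. *)
Definition is_weak_integral (w : R * R -> R[i]) (v : R * R -> R -> R[i])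
    (Phi : R -> R[i]) : Prop :=
  L2 Phi /\
  forall h, L2 h ->
    Cintegrable mu2 (fun p => w p * inner (v p) h) /\
    Cintegral mu2 (fun p => w p * inner (v p) h) = inner Phi h.

End GaborSuperoscillation.

(* Main.v *)
Require Import Defs.
From HB Require Import structures.
From mathcomp Require Import all_boot all_order all_algebra.
From mathcomp Require Import all_classical all_reals all_analysis.
From mathcomp Require Import complex.
From mathcomp Require Import measurable_realfun ring lra.

Set Implicit Arguments.
Unset Strict Implicit.
Unset Printing Implicit Defensive.

Import Order.TTheory GRing.Theory Num.Theory.
Import numFieldNormedType.Exports.

Local Open Scope classical_set_scope.
Local Open Scope ring_scope.

(** Write [V_f(u, eta)] for the Gabor coefficient [<f, M_eta T_u g>]. By
    linearity [phi] is [V_G] for [G(t) = F_n(t, a) g(t - x)], so the theorem says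
    that the Gabor system of any nonzero window reproduces [G], up to the
    constant [2 pi ||g||^2]: weakly in [L^2], hence almost everywhere, and also
    at the individual points where [g] has a Lebesgue point and the pointwise
    integral converges.

    At a fixed translation [u] the coefficient is the Fourier transform of the
    integrable function [f(t) conj(g(t - u))]. The integrals over time and
    frequency do not converge absolutely together, so the factor
    [exp(- eps |eta|)] is inserted. Its Fourier transform is the Poisson kernel
    [P_eps(tau) = 2 eps / (eps^2 + tau^2)], of mass [2 pi], and Fubini's theorem
    gives, with [C_{f,h}] the cross-correlation of [f] and [h],
    - the integral of [exp(- eps |eta|) V_f conj(V_h)] over the plane is the
      integral of [P_eps C_{f,h} conj(C_{g,g})] over the line ([damped_moyal]);
    - the integral of [exp(- eps |eta|) V_f(u, eta) (M_eta T_u g)(y)] over the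
      plane is the integral of [P_eps(tau) f(y + tau) conj(C_{g,g}(tau))] over
      the line ([damped_point_identity]).

    Then [eps] tends to 0 on both sides ([undamped_Cintegral]). The left-hand
    sides converge by dominated convergence. The right-hand sides converge
    because the Poisson kernel is an approximate identity at Lebesgue points
    ([poisson_approximate_identity]).

    For the first identity the correlations are continuous, as translations are
    continuous in [L^2] ([L2_translation]). The product [V_f conj(V_h)] is
    integrable because, for [h = f], the damped integrals are bounded uniformly
    in [eps] and monotone convergence makes [V_f] square integrable over the
    plane ([gabor_energy]). The limit is the orthogonality relation [moyal],
    which exhibits [2 pi ||g||^2 G] as a weak integral
    ([gabor_weak_integral]); weak integrals are unique almost everywhere
    ([weak_integral_unique]).

    For the second identity integrability over the plane is assumed. The
    function [G(y + tau) conj(C_{g,g}(tau))] has a Lebesgue point at 0 as soon as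
    [g] has one at [y - x], because the two other factors [F_n] and [C_{g,g}]
    are bounded and continuous; the limit is [gabor_inversion_at]. *)

Notation normc := ComplexField.Normc.normc.

(** * Complex numbers and componentwise measurability *)

Section ComplexNumbers.
Context {R : realType}.
Implicit Types (z w : R[i]) (r : R).

Lemma Re_mulc z w :
  complex.Re (z * w) = complex.Re z * complex.Re w - complex.Im z * complex.Im w.
Proof. by case: z w => a b [c d]. Qed.

Lemma Im_mulc z w :
  complex.Im (z * w) = complex.Re z * complex.Im w + complex.Im z * complex.Re w.
Proof. by case: z w => a b [c d]. Qed.

Lemma Re_addc z w : complex.Re (z + w) = complex.Re z + complex.Re w.
Proof. by case: z w => a b [c d]. Qed.

Lemma Im_addc z w : complex.Im (z + w) = complex.Im z + complex.Im w.
Proof. by case: z w => a b [c d]. Qed.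

Lemma Re_oppc z : complex.Re (- z) = - complex.Re z.
Proof. by case: z. Qed.

Lemma Im_oppc z : complex.Im (- z) = - complex.Im z.
Proof. by case: z. Qed.

Lemma Re_conjc z : complex.Re (conjc z) = complex.Re z.
Proof. by case: z. Qed.

Lemma Im_conjc z : complex.Im (conjc z) = - complex.Im z.
Proof. by case: z. Qed.

Lemma complex_ext z w :
  complex.Re z = complex.Re w -> complex.Im z = complex.Im w -> z = w.
Proof. by case: z w => a b [c d] /= -> ->. Qed.

Lemma normcE2 z :
  normc z = Num.sqrt (complex.Re z ^+ 2 + complex.Im z ^+ 2).
Proof. by case: z. Qed.

Lemma normc_ge0 z : 0 <= normc z.
Proof. by rewrite normcE2 sqrtr_ge0. Qed.

Lemma sqr_normcE z : normc z ^+ 2 = complex.Re z ^+ 2 + complex.Im z ^+ 2.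
Proof. by rewrite normcE2 sqr_sqrtr// addr_ge0// sqr_ge0. Qed.

Lemma normcMr z w : normc (z * w) = normc z * normc w.
Proof. exact: ComplexField.Normc.normcM. Qed.

Lemma normc_conj z : normc (conjc z) = normc z.
Proof. by rewrite !normcE2 Re_conjc Im_conjc sqrrN. Qed.

Lemma normc_real r : normc (real_complex R r) = `|r|.
Proof. by rewrite normcE2/= expr0n/= addr0 sqrtr_sqr. Qed.

Lemma normc_nneg r : 0 <= r -> normc (real_complex R r) = r.
Proof. by move=> r0; rewrite normc_real ger0_norm. Qed.

Lemma normc_eq0P z : normc z = 0 -> z = 0.
Proof. exact: ComplexField.Normc.eq0_normc. Qed.

Lemma normcBC z w : normc (z - w) = normc (w - z).
Proof. by rewrite -(normcN (z - w)) opprB. Qed.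

Lemma le_normc_add z w : normc (z + w) <= normc z + normc w.
Proof. exact: le_normcD. Qed.

Lemma ler_Re_normc z : `|complex.Re z| <= normc z.
Proof.
by rewrite normcE2 -sqrtr_sqr ler_wsqrtr// lerDl sqr_ge0.
Qed.

Lemma ler_Im_normc z : `|complex.Im z| <= normc z.
Proof.
by rewrite normcE2 -sqrtr_sqr ler_wsqrtr// lerDr sqr_ge0.
Qed.

Lemma normc_le_ReIm z : normc z <= `|complex.Re z| + `|complex.Im z|.
Proof.
rewrite normcE2 -(@ger0_norm _ (`|complex.Re z| + `|complex.Im z|)) ?addr_ge0//.
rewrite -sqrtr_sqr ler_wsqrtr// sqrrD !real_normK ?num_real//.
by rewrite lerD2r lerDl mulrn_wge0// mulr_ge0.
Qed.

Lemma mulc_conj z : z * conjc z = real_complex R (normc z ^+ 2).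
Proof.
apply: complex_ext; rewrite ?Re_mulc ?Im_mulc Re_conjc Im_conjc/=.
  by rewrite sqr_normcE; ring.
by ring.
Qed.

Lemma conjcM z w : conjc (z * w) = conjc z * conjc w.
Proof. by rewrite rmorphM. Qed.

End ComplexNumbers.

Section ComplexMeasurable.
Context d {T : measurableType d} {R : realType}.
Implicit Types (f g : T -> R[i]).

Definition Cmeas f :=
  measurable_fun setT (fun t => complex.Re (f t)) /\
  measurable_fun setT (fun t => complex.Im (f t)).

Lemma CmeasM f g : Cmeas f -> Cmeas g -> Cmeas (fun t => f t * g t).
Proof.
move=> [f1 f2] [g1 g2]; split.
  rewrite (_ : (fun _ => _) = (fun t => complex.Re (f t) * complex.Re (g t)
     - complex.Im (f t) * complex.Im (g t))).
    by apply: measurable_funB; apply: measurable_funM.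
  by apply/funext => t; rewrite Re_mulc.
rewrite (_ : (fun _ => _) = (fun t => complex.Re (f t) * complex.Im (g t)
   + complex.Im (f t) * complex.Re (g t))).
  by apply: measurable_funD; apply: measurable_funM.
by apply/funext => t; rewrite Im_mulc.
Qed.

Lemma CmeasD f g : Cmeas f -> Cmeas g -> Cmeas (fun t => f t + g t).
Proof.
move=> [f1 f2] [g1 g2]; split.
  under eq_fun do rewrite Re_addc; exact: measurable_funD.
under eq_fun do rewrite Im_addc; exact: measurable_funD.
Qed.

Lemma Cmeas_conj f : Cmeas f -> Cmeas (fun t => conjc (f t)).
Proof.
move=> [f1 f2]; split.
  by under eq_fun do rewrite Re_conjc.
under eq_fun do rewrite Im_conjc; exact: measurableT_comp.
Qed.

Lemma Cmeas_cst (z : R[i]) : Cmeas (fun=> z).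
Proof. by split; exact: measurable_cst. Qed.

Lemma Cmeas_real (h : T -> R) :
  measurable_fun setT h -> Cmeas (fun t => real_complex R (h t)).
Proof. by move=> mh; split => //=. Qed.

Lemma CmeasB f g : Cmeas f -> Cmeas g -> Cmeas (fun t => f t - g t).
Proof.
move=> mf mg; rewrite (_ : (fun _ => _) = (fun t => f t + (-1) * g t)).
  by apply: CmeasD => //; apply: CmeasM => //; exact: Cmeas_cst.
by apply/funext => t; rewrite mulN1r.
Qed.

Lemma Cmeas_normc f : Cmeas f -> measurable_fun setT (fun t => normc (f t)).
Proof.
move=> [f1 f2]; under eq_fun do rewrite normcE2.
apply: measurableT_comp; first by apply: continuous_measurable_fun; exact: sqrt_continuous.
by apply: measurable_funD; apply: measurable_funX.
Qed.

Lemma Cmeas_sum (I : Type) (s : seq I) (F : I -> T -> R[i]) :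
  (forall i, Cmeas (F i)) -> Cmeas (fun t => \sum_(i <- s) F i t).
Proof.
move=> mF; elim: s => [|i s IH].
  by under eq_fun do rewrite big_nil; exact: Cmeas_cst.
by under eq_fun do rewrite big_cons; exact: CmeasD.
Qed.

End ComplexMeasurable.

Lemma Cmeas_comp d d' (T : measurableType d) (T' : measurableType d')
    (R : realType) (phi : T -> T') (f : T' -> R[i]) :
  measurable_fun setT phi -> Cmeas f -> Cmeas (fun t => f (phi t)).
Proof.
move=> mphi [f1 f2]; split; [exact: (measurableT_comp f1 mphi)|].
exact: (measurableT_comp f2 mphi).
Qed.

(** * Integrals of complex-valued functions *)

Section ComplexIntegral.
Context d {T : measurableType d} {R : realType} (mu : {measure set T -> \bar R}).
Implicit Types (f g : T -> R[i]) (G : T -> R).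

Lemma Cintegrable_meas f : Cintegrable mu f -> Cmeas f.
Proof.
by move=> [/measurable_int/measurable_EFinP ? /measurable_int/measurable_EFinP ?].
Qed.

Lemma Cintegrable_dom f G : Cmeas f -> (forall t, normc (f t) <= G t) ->
  mu.-integrable setT (EFin \o G) -> Cintegrable mu f.
Proof.
move=> [mf1 mf2] fG iG; split.
  apply: (le_integrable _ _ _ iG) => //; first exact/measurable_EFinP.
  move=> t _ /=; rewrite lee_fin (le_trans (ler_Re_normc _))//.
  by rewrite (le_trans (fG t))// ler_norm.
apply: (le_integrable _ _ _ iG) => //; first exact/measurable_EFinP.
move=> t _ /=; rewrite lee_fin (le_trans (ler_Im_normc _))//.
by rewrite (le_trans (fG t))// ler_norm.
Qed.

Lemma Cintegrable_normc f : Cintegrable mu f ->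
  mu.-integrable setT (EFin \o (fun t => normc (f t))).
Proof.
move=> fi; have mf := Cintegrable_meas fi; case: fi => f1 f2.
have i12 : mu.-integrable setT (EFin \o (fun t => `|complex.Re (f t)| + `|complex.Im (f t)|)).
  rewrite (_ : _ \o _ = ((fun t => `|complex.Re (f t)|%:E) \+ (fun t => `|complex.Im (f t)|%:E))%E)//.
  by apply: integrableD => //; exact: integrable_norm.
apply: (le_integrable _ _ _ i12) => //.
  by apply/measurable_EFinP; exact: Cmeas_normc.
move=> t _ /=; rewrite lee_fin ger0_norm ?normc_ge0//.
by rewrite (le_trans (normc_le_ReIm _))// ler_norm.
Qed.

Lemma Cintegrable_lty f : Cmeas f ->
  (\int[mu]_t (normc (f t))%:E < +oo)%E -> Cintegrable mu f.
Proof.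
move=> mf foo; apply: (@Cintegrable_dom _ (fun t => normc (f t))) => //.
apply/integrableP; split; first by apply/measurable_EFinP; exact: Cmeas_normc.
by under eq_integral do rewrite gee0_abs ?lee_fin ?normc_ge0//.
Qed.

Lemma CintegrableD f g : Cintegrable mu f -> Cintegrable mu g ->
  Cintegrable mu (fun t => f t + g t).
Proof.
move=> [f1 f2] [g1 g2]; split.
  rewrite (_ : _ \o _ = ((EFin \o (fun t => complex.Re (f t))) \+
    (EFin \o (fun t => complex.Re (g t))))%E); first exact: integrableD.
  by apply/funext => t /=; rewrite Re_addc.
rewrite (_ : _ \o _ = ((EFin \o (fun t => complex.Im (f t))) \+
  (EFin \o (fun t => complex.Im (g t))))%E); first exact: integrableD.
by apply/funext => t /=; rewrite Im_addc.
Qed.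

Lemma CintegralD f g : Cintegrable mu f -> Cintegrable mu g ->
  Cintegral mu (fun t => f t + g t) = Cintegral mu f + Cintegral mu g.
Proof.
move=> [f1 f2] [g1 g2]; apply: complex_ext; rewrite /= -RintegralD//.
  by congr Rintegral; apply/funext => t; rewrite Re_addc.
by congr Rintegral; apply/funext => t; rewrite Im_addc.
Qed.

Lemma CintegrableZl (z : R[i]) f : Cintegrable mu f ->
  Cintegrable mu (fun t => z * f t).
Proof.
move=> fi; apply: (@Cintegrable_dom _ (fun t => normc z * normc (f t))).
- by apply: CmeasM; [exact: Cmeas_cst|exact: Cintegrable_meas].
- by move=> t; rewrite normcMr.
- rewrite (_ : _ \o _ = (fun t => (normc z)%:E * (normc (f t))%:E)%E)//.
  by apply: integrableZl => //; exact: Cintegrable_normc.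
Qed.

Lemma CintegralZl (z : R[i]) f : Cintegrable mu f ->
  Cintegral mu (fun t => z * f t) = z * Cintegral mu f.
Proof.
move=> [f1 f2].
have Zi (k : R) (h : T -> R) : mu.-integrable setT (EFin \o h) ->
    mu.-integrable setT (EFin \o (fun t => k * h t)).
  by move=> hi; exact: (integrableZl measurableT k hi).
apply: complex_ext; rewrite ?Re_mulc ?Im_mulc /= -!RintegralZl//.
  rewrite -RintegralB//; try exact: Zi.
  by congr Rintegral; apply/funext => t; rewrite Re_mulc.
rewrite -RintegralD//; try exact: Zi.
by congr Rintegral; apply/funext => t; rewrite Im_mulc.
Qed.

Lemma CintegralZr (z : R[i]) f : Cintegrable mu f ->
  Cintegral mu (fun t => f t * z) = Cintegral mu f * z.
Proof.
by move=> fi; under eq_fun do rewrite mulrC; rewrite CintegralZl// mulrC.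
Qed.

Lemma CintegrableZr (z : R[i]) f : Cintegrable mu f ->
  Cintegrable mu (fun t => f t * z).
Proof. by move=> fi; under eq_fun do rewrite mulrC; exact: CintegrableZl. Qed.

Lemma CintegrableB f g : Cintegrable mu f -> Cintegrable mu g ->
  Cintegrable mu (fun t => f t - g t).
Proof.
move=> fi gi; rewrite (_ : (fun _ => _) = (fun t => f t + (-1) * g t)).
  by apply: CintegrableD => //; exact: CintegrableZl.
by apply/funext => t; rewrite mulN1r.
Qed.

Lemma CintegralB f g : Cintegrable mu f -> Cintegrable mu g ->
  Cintegral mu (fun t => f t - g t) = Cintegral mu f - Cintegral mu g.
Proof.
move=> fi gi; rewrite (_ : (fun _ => _) = (fun t => f t + (-1) * g t)).
  by rewrite CintegralD ?CintegralZl ?mulN1r//; exact: CintegrableZl.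
by apply/funext => t; rewrite mulN1r.
Qed.

Lemma Cintegral0 : Cintegral mu (fun=> 0) = 0 :> R[i].
Proof.
by apply: complex_ext; rewrite /= /Rintegral; rewrite integral0_eq.
Qed.

Lemma Cintegrable0 : Cintegrable mu (fun=> 0 : R[i]).
Proof. by split; exact: integrable0. Qed.

Lemma Cintegrable_sum (I : Type) (s : seq I) (F : I -> T -> R[i]) :
  (forall i, Cintegrable mu (F i)) ->
  Cintegrable mu (fun t => \sum_(i <- s) F i t).
Proof.
move=> Fi; elim: s => [|i s IH].
  by under eq_fun do rewrite big_nil; exact: Cintegrable0.
by under eq_fun do rewrite big_cons; exact: CintegrableD.
Qed.

Lemma Cintegral_sum (I : Type) (s : seq I) (F : I -> T -> R[i]) :
  (forall i, Cintegrable mu (F i)) ->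
  Cintegral mu (fun t => \sum_(i <- s) F i t) =
  \sum_(i <- s) Cintegral mu (F i).
Proof.
move=> Fi; elim: s => [|i s IH].
  by under eq_fun do rewrite big_nil; rewrite big_nil Cintegral0.
under eq_fun do rewrite big_cons.
by rewrite big_cons CintegralD ?IH//; exact: Cintegrable_sum.
Qed.

Lemma Cintegrable_conj f : Cintegrable mu f ->
  Cintegrable mu (fun t => conjc (f t)).
Proof.
move=> fi; apply: (@Cintegrable_dom _ (fun t => normc (f t))).
- exact/Cmeas_conj/Cintegrable_meas.
- by move=> t; rewrite normc_conj.
- exact: Cintegrable_normc.
Qed.

Lemma Cintegral_conj f : Cintegrable mu f ->
  Cintegral mu (fun t => conjc (f t)) = conjc (Cintegral mu f).
Proof.
move=> [f1 f2]; apply: complex_ext; rewrite ?Re_conjc ?Im_conjc/=.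
  by congr Rintegral; apply/funext => t; rewrite Re_conjc.
rewrite -mulN1r -RintegralZl//.
by congr Rintegral; apply/funext => t; rewrite Im_conjc mulN1r.
Qed.

(** Rotating the integral onto the real axis reduces this to the monotonicity
    of the real integral. *)
Lemma le_normc_Cintegral f : Cintegrable mu f ->
  normc (Cintegral mu f) <= \int[mu]_t normc (f t).
Proof.
move=> fi; set z := Cintegral mu f.
have [z0|z0] := eqVneq (normc z) 0.
  by rewrite z0; apply: Rintegral_ge0 => t _; exact: normc_ge0.
have zp : 0 < normc z by rewrite lt_neqAle eq_sym z0 normc_ge0.
rewrite -(ler_pM2l zp) -expr2.
have -> : normc z ^+ 2 = complex.Re (Cintegral mu (fun t => conjc z * f t)).
  by rewrite CintegralZl// mulrC mulc_conj.
have ni := Cintegrable_normc fi.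
rewrite -RintegralZl//.
rewrite [X in X <= _](_ : _ = \int[mu]_t complex.Re (conjc z * f t)) //.
apply: le_Rintegral => //.
- by have [] := CintegrableZl (conjc z) fi.
- exact: (integrableZl measurableT (normc z) ni).
- move=> t _; rewrite (le_trans (ler_norm _))// (le_trans (ler_Re_normc _))//.
  by rewrite normcMr normc_conj.
Qed.

Lemma le_normc_CintegralB f g : Cintegrable mu f -> Cintegrable mu g ->
  normc (Cintegral mu f - Cintegral mu g) <= \int[mu]_t normc (f t - g t).
Proof.
by move=> fi gi; rewrite -CintegralB//; apply/le_normc_Cintegral/CintegrableB.
Qed.

(** Continuity at 0 of the regularised integral: by monotonicity in [eps] it is
    enough to let [eps] run through 1/(n+1), where dominated convergence
    applies. *)
Lemma exp_damping_cvg (w : T -> R) f :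
  measurable_fun setT w -> (forall t, 0 <= w t) -> Cintegrable mu f ->
  forall delta, 0 < delta -> exists2 eps0, 0 < eps0 &
    forall eps, 0 < eps <= eps0 ->
    normc (Cintegral mu (fun t => real_complex R (expR (- (eps * w t))) * f t)
           - Cintegral mu f) <= delta.
Proof.
move=> mw w0 fi delta delta0.
have ni := Cintegrable_normc fi.
have mf := Cintegrable_meas fi.
pose e (n : nat) t := 1 - expR (- (n.+1%:R^-1 * w t)).
have expr_le1 (a : R) t : 0 <= a -> expR (- (a * w t)) <= 1.
  by move=> a0; rewrite -expR0 ler_expR oppr_le0 mulr_ge0.
have e0 n t : 0 <= e n t by rewrite subr_ge0 expr_le1.
have e1 n t : e n t <= 1 by rewrite gerBl expR_ge0.
have mexp (a : R) : measurable_fun setT (fun t => expR (- (a * w t))).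
  apply: (measurableT_comp (@measurable_expR R)); apply: measurableT_comp => //.
  by apply: measurable_funM.
have me n : measurable_fun setT (e n) by apply: measurable_funB.
have [] := @dominated_convergence _ _ _ mu setT measurableT
  (fun n t => (e n t * normc (f t))%:E) (fun=> 0%E)
  (EFin \o (fun t => normc (f t))).
- move=> n; apply/measurable_EFinP; apply: measurable_funM => //.
  exact: Cmeas_normc.
- exact: measurable_cst.
- apply: aeW => t _; apply: cvg_EFin; first by near=> n.
  rewrite -[X in _ --> X](mul0r (normc (f t))).
  apply: cvgM; last exact: cvg_cst.
  rewrite -[X in _ --> X](subrr (1:R)); apply: cvgB; first exact: cvg_cst.
  rewrite [X in _ --> X](_ : 1 = expR (- 0)); last by rewrite oppr0 expR0.
  apply: continuous_cvg; first exact: continuous_expR.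
  apply: cvgN; rewrite -[X in _ --> X](mul0r (w t)).
  apply: cvgM; last exact: cvg_cst.
  exact: cvg_harmonic.
- exact: ni.
- apply: aeW => t n _ /=; rewrite lee_fin normrM !ger0_norm ?normc_ge0//.
  by rewrite ler_piMl ?normc_ge0.
move=> _ _; rewrite integral0 => cv.
have {}cv : (\int[mu]_t (e n t * normc (f t))) @[n --> \oo] --> (0 : R).
  exact: (fine_cvg cv).
have [N _ HN] := cvgr_lt _ cv _ delta0.
exists N.+1%:R^-1; first by rewrite invr_gt0.
move=> eps /andP[eps0 epsN].
have fe : Cintegrable mu (fun t => real_complex R (expR (- (eps * w t))) * f t).
  apply: (Cintegrable_dom _ _ ni).
    by apply: CmeasM => //; apply: Cmeas_real.
  move=> t; rewrite normcMr normc_nneg ?expR_ge0//.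
  by rewrite ler_piMl ?normc_ge0// expr_le1// ltW.
apply: (le_trans (le_normc_CintegralB fe fi)).
apply: le_trans (ltW (HN N (leqnn N))).
have ieN : mu.-integrable setT (EFin \o (fun t => e N t * normc (f t))).
  apply: (le_integrable _ _ _ ni) => //.
    by apply/measurable_EFinP; apply: measurable_funM => //; exact: Cmeas_normc.
  move=> t _ /=; rewrite lee_fin normrM !ger0_norm ?normc_ge0//.
  by rewrite ler_piMl ?normc_ge0.
apply: le_Rintegral => //.
  exact/Cintegrable_normc/CintegrableB.
move=> t _.
rewrite -[X in _ - X]mul1r -mulrBl normcMr ler_wpM2r ?normc_ge0//.
rewrite normcBC -(rmorph1 (real_complex R)) -rmorphB normc_nneg ?subr_ge0 ?expr_le1 ?(ltW eps0)//.
by rewrite /e lerD2l lerN2 ler_expR lerN2 ler_wpM2r.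
Unshelve. all: by end_near. Qed.

End ComplexIntegral.

Section NonnegativeRealIntegrals.
Context d {T : measurableType d} {R : realType} (mu : {measure set T -> \bar R}).
Implicit Types (F G : T -> R).

Lemma integral_addE F G : measurable_fun setT F -> measurable_fun setT G ->
  (forall t, 0 <= F t) -> (forall t, 0 <= G t) ->
  (\int[mu]_t (F t + G t)%:E = \int[mu]_t (F t)%:E + \int[mu]_t (G t)%:E)%E.
Proof.
move=> mF mG F0 G0.
rewrite -ge0_integralD//; try by move=> t _; rewrite lee_fin.
  exact/measurable_EFinP.
exact/measurable_EFinP.
Qed.

Lemma integral_scaleE (c : R) F : measurable_fun setT F -> 0 <= c ->
  (forall t, 0 <= F t) ->
  (\int[mu]_t (c * F t)%:E = c%:E * \int[mu]_t (F t)%:E)%E.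
Proof.
move=> mF c0 F0; rewrite -ge0_integralZl//.
- exact/measurable_EFinP.
- by move=> t _; rewrite lee_fin.
Qed.

Lemma integral_leE F G : measurable_fun setT F -> measurable_fun setT G ->
  (forall t, 0 <= F t) -> (forall t, F t <= G t) ->
  (\int[mu]_t (F t)%:E <= \int[mu]_t (G t)%:E)%E.
Proof.
move=> mF mG F0 FG; apply: ge0_le_integral => //.
- by move=> t _; rewrite lee_fin.
- exact/measurable_EFinP.
- exact/measurable_EFinP.
- by move=> t _; rewrite lee_fin.
Qed.

Lemma integrable_nonneg F : measurable_fun setT F -> (forall t, 0 <= F t) ->
  (\int[mu]_t (F t)%:E < +oo)%E -> mu.-integrable setT (EFin \o F).
Proof.
move=> mF F0 Foo; apply/integrableP; split; first exact/measurable_EFinP.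
by under eq_integral do rewrite gee0_abs ?lee_fin//.
Qed.

Lemma integrable_nonneg_lty F : mu.-integrable setT (EFin \o F) ->
  (\int[mu]_t (F t)%:E < +oo)%E.
Proof. by move=> iF; have := integrable_fin_num measurableT iF; rewrite fin_numElt => /andP[]. Qed.

Lemma Rintegral_EFin F : mu.-integrable setT (EFin \o F) ->
  (\int[mu]_t F t)%:E = (\int[mu]_t (F t)%:E)%E.
Proof. by move=> iF; rewrite fineK//; exact: integrable_fin_num iF. Qed.

End NonnegativeRealIntegrals.

(** * Fubini's theorem and changes of variable *)

Section RealPartOfIntegral.
Context d {T : measurableType d} {R : realType} (mu : {measure set T -> \bar R}).

Lemma integrable_fine (F : T -> \bar R) : mu.-integrable setT F ->
  mu.-integrable setT (EFin \o (fun x => fine (F x))).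
Proof.
move=> iF; apply: (le_integrable _ _ _ iF) => //.
  apply/measurable_EFinP; apply: (measurableT_comp (fine_measurable measurableT)).
  exact: measurable_int iF.
by move=> x _ /=; case: (F x) => [r| |] //=; rewrite ?normr0 ?leey.
Qed.

Lemma integral_fine (F : T -> \bar R) : mu.-integrable setT F ->
  (\int[mu]_x (fine (F x))%:E = \int[mu]_x F x)%E.
Proof.
move=> iF; apply: ae_eq_integral => //.
- exact/(measurable_int _ (integrable_fine iF)).
- exact: measurable_int iF.
- have := integrable_ae measurableT iF; apply: filterS => x h _.
  by rewrite fineK// h.
Qed.

End RealPartOfIntegral.

Section ComplexFubini.
Context d1 d2 (T1 : measurableType d1) (T2 : measurableType d2) (R : realType).
Variables (m1 : {sigma_finite_measure set T1 -> \bar R})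
          (m2 : {sigma_finite_measure set T2 -> \bar R}).
Implicit Types F : T1 * T2 -> R[i].
Local Notation m12 := (m1 \x m2)%E.

Lemma Rintegral12 (f : T1 * T2 -> R) : m12.-integrable setT (EFin \o f) ->
  \int[m1]_x \int[m2]_y f (x, y) = \int[m12]_z f z.
Proof.
move=> fi; rewrite /Rintegral (integral_fine (integrable_fubini_F fi)).
by rewrite -(integral12_prod_meas1 fi).
Qed.

Lemma Rintegral21 (f : T1 * T2 -> R) : m12.-integrable setT (EFin \o f) ->
  \int[m2]_y \int[m1]_x f (x, y) = \int[m12]_z f z.
Proof.
move=> fi; rewrite -Rintegral12// /Rintegral.
have := Fubini fi; rewrite /= => FE.
rewrite (integral_fine (integrable_fubini_F fi)).
have -> : (\int[m2]_y (fine (\int[m1]_x (f (x, y))%:E))%:E =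
  \int[m2]_y \int[m1]_x (f (x, y))%:E)%E.
  apply: (integral_fine (F := fubini_G m1 (EFin \o f))).
  apply/integrableP; split; first exact: (measurable_fubini_G fi).
  have := (integrable21ltyP m1 m2 (measurable_int _ fi)).1 fi.
  apply: le_lt_trans; apply: ge0_le_integral => //.
  - apply: measurableT_comp => //; exact: (measurable_fubini_G fi).
  - apply: (measurable_fun_fubini_tonelli_G (abse \o (EFin \o f))) => //=.
    by apply: measurableT_comp => //; exact: measurable_int fi.
  - move=> y _; apply: le_abse_integral => //.
    by apply: (measurableT_comp (measurable_int _ fi)); exact: pair2_measurable.
by congr fine; rewrite FE.
Qed.

Lemma Cintegral12 F : Cintegrable m12 F ->
  Cintegral m1 (fun x => Cintegral m2 (fun y => F (x, y))) = Cintegral m12 F.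
Proof. by move=> [F1 F2]; apply: complex_ext => /=; exact: Rintegral12. Qed.

Lemma Cintegral21 F : Cintegrable m12 F ->
  Cintegral m2 (fun y => Cintegral m1 (fun x => F (x, y))) = Cintegral m12 F.
Proof. by move=> [F1 F2]; apply: complex_ext => /=; exact: Rintegral21. Qed.

Lemma Cintegral_swap F : Cintegrable m12 F ->
  Cintegral m1 (fun x => Cintegral m2 (fun y => F (x, y))) =
  Cintegral m2 (fun y => Cintegral m1 (fun x => F (x, y))).
Proof. by move=> Fi; rewrite Cintegral12// Cintegral21. Qed.

(** The positive and negative parts are measurable by Tonelli, so the integral
    need not converge. *)
Lemma Cmeas_param F : Cmeas F ->
  Cmeas (fun x => Cintegral m2 (fun y => F (x, y))).
Proof.
have key (f : T1 * T2 -> R) : measurable_fun setT f ->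
    measurable_fun setT (fun x => \int[m2]_y f (x, y)).
  move=> mf.
  have mf' : measurable_fun setT (EFin \o f) by exact/measurable_EFinP.
  suff mI : measurable_fun setT (fun x => (\int[m2]_y (f (x, y))%:E)%E).
    exact: (measurableT_comp (fine_measurable measurableT) mI).
  have -> : (fun x => (\int[m2]_y (f (x, y))%:E)%E) =
      (fubini_F m2 ((EFin \o f)^\+) \- fubini_F m2 ((EFin \o f)^\-))%E.
    apply/funext => x; rewrite [LHS]integralE.
    rewrite /fubini_F.
    by congr (_ - _)%E; apply: eq_integral => y _; rewrite ?funeposE ?funenegE.
  apply: emeasurable_funB.
    apply: (measurable_fun_fubini_tonelli_F (m2 := m2) ((EFin \o f)^\+)%E) => //.
    exact: measurable_funepos.
  apply: (measurable_fun_fubini_tonelli_F (m2 := m2) ((EFin \o f)^\-)%E) => //.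
  exact: measurable_funeneg.
move=> [F1 F2]; split.
  exact: (key (fun p => complex.Re (F p)) F1).
exact: (key (fun p => complex.Im (F p)) F2).
Qed.

Lemma Cintegrable_prod21 F : Cmeas F ->
  (\int[m2]_y \int[m1]_x (normc (F (x, y)))%:E < +oo)%E -> Cintegrable m12 F.
Proof.
move=> mF Foo; apply: Cintegrable_lty => //.
rewrite fubini_tonelli2//; last by move=> z; rewrite lee_fin normc_ge0.
exact/measurable_EFinP/Cmeas_normc.
Qed.

Lemma integrable_tensor (a : T1 -> R) (b : T2 -> R) :
  m1.-integrable setT (EFin \o a) -> m2.-integrable setT (EFin \o b) ->
  m12.-integrable setT (EFin \o (fun p => a p.1 * b p.2)).
Proof.
move=> ia ib.
have ma : measurable_fun setT a by exact: (measurable_EFinP _ _).1 (measurable_int _ ia).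
have mb : measurable_fun setT b by exact: (measurable_EFinP _ _).1 (measurable_int _ ib).
have mab : measurable_fun setT (fun p : T1 * T2 => a p.1 * b p.2).
  apply: measurable_funM; first exact: (measurableT_comp ma).
  exact: (measurableT_comp mb).
apply/integrable12ltyP; first exact/measurable_EFinP.
have mb' : measurable_fun setT (fun y => `|b y|%:E).
  by apply/measurable_EFinP; exact: measurableT_comp.
have ma' : measurable_fun setT (fun x => `|a x|%:E).
  by apply/measurable_EFinP; exact: measurableT_comp.
rewrite (_ : (\int[m1]_x _ = \int[m1]_x (`|a x|%:E * \int[m2]_y `|b y|%:E))%E);
    last first.
  apply: eq_integral => x _; rewrite -ge0_integralZl//.
  by apply: eq_integral => y _; rewrite /= normrM.
rewrite ge0_integralZr//; last exact: integral_ge0.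
have /integrableP[_ a1] := ia; have /integrableP[_ b1] := ib.
by rewrite lte_mul_pinfty// ?integral_ge0// ge0_fin_numE// integral_ge0.
Qed.

End ComplexFubini.

Section LineChangeOfVariable.
Context {R : realType}.
Implicit Types (a : R) (f : R -> \bar R) (F : R -> R[i]).
Local Notation mu := (@lebesgue_measure R).

Lemma measurable_shift a : measurable_fun setT (fun t : R => t + a).
Proof. by apply: measurable_funD. Qed.

Lemma measurable_reflect a : measurable_fun setT (fun t : R => a - t).
Proof. by apply: measurable_funB. Qed.

Lemma lebesgue_measure_shift a (A : set R) : measurable A ->
  pushforward mu ((fun t : R => t + a) : _ -> measurableTypeR R) A = mu A.
Proof.
move=> mA; apply/esym/lebesgue_measure_unique => //=.
  exact: measurable_shift.
move=> _ _ [[b c]] _ <-.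
rewrite /pushforward (_ : _ @^-1` _ = `]b - a, c - a]%classic); last first.
  by apply/seteqP; split => t /=; rewrite !in_itv/= ltrBlDr lerBrDr.
rewrite !lebesgue_measure_itv/= !lte_fin ltrD2r.
by case: ifPn => // _; rewrite -!EFinB; congr EFin; ring.
Qed.

Lemma lebesgue_measure_reflect a (A : set R) : measurable A ->
  pushforward mu ((fun t : R => a - t) : _ -> measurableTypeR R) A = mu A.
Proof.
move=> mA; rewrite -[RHS](lebesgue_measure_shift a)//.
rewrite -[RHS]lebesgue_measureN; last first.
  rewrite -[X in measurable X]setTI.
  exact: (measurable_shift a).
rewrite /pushforward; congr (_ _); apply/seteqP; split => t /=;
  by rewrite addrC.
Qed.

Lemma ge0_integral_shift a f : measurable_fun setT f -> (forall t, 0 <= f t)%E ->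
  (\int[mu]_t f (t + a)%R = \int[mu]_t f t)%E.
Proof.
move=> mf f0.
transitivity (\int[pushforward mu ((fun t : R => t + a)%R : _ -> measurableTypeR R)]_t f t)%E.
  rewrite ge0_integral_pushforward//.
  exact: measurable_shift.
apply: eq_measure_integral => [|mphi A mA _].
  exact: measurable_shift.
exact: lebesgue_measure_shift.
Qed.

Lemma ge0_integral_reflect a f : measurable_fun setT f -> (forall t, 0 <= f t)%E ->
  (\int[mu]_t f (a - t)%R = \int[mu]_t f t)%E.
Proof.
move=> mf f0.
transitivity (\int[pushforward mu ((fun t : R => a - t)%R : _ -> measurableTypeR R)]_t f t)%E.
  rewrite ge0_integral_pushforward//.
  exact: measurable_reflect.
apply: eq_measure_integral => [|mphi A mA _].
  exact: measurable_reflect.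
exact: lebesgue_measure_reflect.
Qed.

Lemma integral_shift a f : measurable_fun setT f ->
  (\int[mu]_t f (t + a)%R = \int[mu]_t f t)%E.
Proof.
move=> mf; rewrite integralE [RHS]integralE.
rewrite -(ge0_integral_shift a (measurable_funepos mf))//.
rewrite -(ge0_integral_shift a (measurable_funeneg mf))//.
by congr (_ - _)%E; apply: eq_integral => t _; rewrite ?funeposE ?funenegE.
Qed.

Lemma integral_reflect a f : measurable_fun setT f ->
  (\int[mu]_t f (a - t)%R = \int[mu]_t f t)%E.
Proof.
move=> mf; rewrite integralE [RHS]integralE.
rewrite -(ge0_integral_reflect a (measurable_funepos mf))//.
rewrite -(ge0_integral_reflect a (measurable_funeneg mf))//.
by congr (_ - _)%E; apply: eq_integral => t _; rewrite ?funeposE ?funenegE.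
Qed.

Lemma Cintegral_shift a F : Cmeas F ->
  Cintegral mu (fun t => F (t + a)) = Cintegral mu F.
Proof.
move=> [F1 F2]; apply: complex_ext => /=; congr fine.
  exact: (integral_shift a (proj2 (measurable_EFinP _ _) F1)).
exact: (integral_shift a (proj2 (measurable_EFinP _ _) F2)).
Qed.

Lemma Cintegral_reflect a F : Cmeas F ->
  Cintegral mu (fun t => F (a - t)) = Cintegral mu F.
Proof.
move=> [F1 F2]; apply: complex_ext => /=; congr fine.
  exact: (integral_reflect a (proj2 (measurable_EFinP _ _) F1)).
exact: (integral_reflect a (proj2 (measurable_EFinP _ _) F2)).
Qed.

End LineChangeOfVariable.

(** * Continuity of translations in L^1 *)

Section TranslationL1.
Import HBSimple.
Context {R : realType}.
Implicit Types (F G : R -> R).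
Local Notation mu := (@lebesgue_measure R).

Definition L1_translation_continuous F := forall delta, 0 < delta ->
  exists2 r, 0 < r & forall tau, `|tau| <= r ->
  (\int[mu]_t `|F (t + tau)%R - F t|%:E <= delta%:E)%E.

Lemma measurable_translate F tau :
  measurable_fun setT F -> measurable_fun setT (fun t : R => F (t + tau)).
Proof. by move=> mF; exact: (measurableT_comp mF (measurable_shift tau)). Qed.

Lemma measurable_increment F tau : measurable_fun setT F ->
  measurable_fun setT (fun t : R => (`|F (t + tau)%R - F t|)%:E).
Proof.
move=> mF; apply/measurable_EFinP; apply: measurableT_comp => //.
by apply: measurable_funB => //; exact: measurable_translate.
Qed.

Lemma L1_translationD F G : measurable_fun setT F -> measurable_fun setT G ->
  L1_translation_continuous F -> L1_translation_continuous G ->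
  L1_translation_continuous (fun t => F t + G t).
Proof.
move=> mF mG cF cG delta delta0.
have d2 : 0 < delta / 2 by rewrite divr_gt0.
have [r1 r10 H1] := cF _ d2; have [r2 r20 H2] := cG _ d2.
exists (Num.min r1 r2); first by rewrite lt_min r10.
move=> tau; rewrite le_min => /andP[t1 t2].
rewrite [delta]splitr EFinD (le_trans _ (leeD (H1 _ t1) (H2 _ t2)))//.
have mi H (mH : measurable_fun setT H) := (measurable_EFinP _ _).1 (measurable_increment tau mH).
rewrite -integral_addE//; [|exact: mi|exact: mi].
apply: integral_leE => //; first by apply: mi; exact: measurable_funD.
  by apply: measurable_funD; exact: mi.
move=> t; rewrite (le_trans _ (ler_normD _ _))//.
by rewrite le_eqVlt; apply/orP; left; apply/eqP; congr `|_|; ring.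
Qed.

Lemma L1_translationZ (c : R) F : measurable_fun setT F ->
  L1_translation_continuous F -> L1_translation_continuous (fun t => c * F t).
Proof.
move=> mF cF delta delta0.
have c1 : 0 < `|c| + 1 by rewrite ltr_wpDl.
have [r r0 H] := cF (delta / (`|c| + 1)) (divr_gt0 delta0 c1).
exists r => // tau tr.
under eq_integral do rewrite -mulrBr normrM.
rewrite integral_scaleE//; last exact: ((measurable_EFinP _ _).1 (measurable_increment tau mF)).
apply: le_trans; first by apply: (lee_wpmul2l _ (H _ tr)); rewrite lee_fin.
by rewrite -EFinM lee_fin mulrA ler_pdivrMr// mulrC ler_pM2l// lerDl.
Qed.

Lemma L1_translation0 : L1_translation_continuous (fun=> 0).
Proof.
move=> delta delta0; exists 1 => // tau _.
under eq_integral do rewrite subrr normr0.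
by rewrite integral0 lee_fin ltW.
Qed.

Lemma L1_translation_sum (I : Type) (s : seq I) (F : I -> R -> R) :
  (forall i, measurable_fun setT (F i) /\ L1_translation_continuous (F i)) ->
  L1_translation_continuous (fun t => \sum_(i <- s) F i t).
Proof.
move=> mF; elim: s => [|i s IH].
  by under eq_fun do rewrite big_nil; exact: L1_translation0.
under eq_fun do rewrite big_cons.
apply: L1_translationD => //; try exact: (mF i).1; try exact: (mF i).2.
by apply: measurable_sum => k; exact: (mF k).1.
Qed.

(** If [1_E] differs at [t] and [t + tau] then one of the two points lies in
    the thin set [U `\` K], as soon as [K + tau] stays inside [U]. *)
Lemma L1_translation_indic (E : set R) : measurable E -> (mu E < +oo)%E ->
  L1_translation_continuous \1_E.
Proof.
move=> mE Eoo delta delta0.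
have d4 : 0 < delta / 4 by rewrite divr_gt0.
have [U [oU EU Ud]] := lebesgue_regularity_outer mE Eoo d4.
have [K [cK KE Kd]] := lebesgue_regularity_inner mE Eoo d4.
have mU : measurable U by exact: open_measurable.
have mK : measurable K by exact: compact_measurable.
have mUK : measurable (U `\` K) by exact: measurableD.
have UKd : (mu (U `\` K) <= (delta / 2)%:E)%E.
  apply: (@le_trans _ _ (mu ((U `\` E) `|` (E `\` K)))).
    apply: le_measure; rewrite ?inE//.
      by apply: measurableU; exact: measurableD.
    by move=> t [Ut nKt]; have [Et|nEt] := pselect (E t); [right|left].
  apply: (le_trans (measureU2 _ _ _)); [exact: measurableD|exact: measurableD|].
  have -> : delta / 2 = delta / 4 + delta / 4 by field.
  by rewrite EFinD leeD// ltW.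
have [r r0 Kr] : exists2 r, 0 < r & forall t tau, K t -> `|tau| <= r -> U (t + tau).
  have : \forall tau \near (0 : R), K `<=` (fun t => U (t + tau)).
    apply: (proj1 (compact_near_coveringP K) cK R (nbhs (0:R)) (fun tau t => U (t + tau))).
    move=> t Kt.
    have : \forall z \near ((t, 0) : R * R), U (z.1 + z.2).
      have cadd : continuous (fun z : R * R => z.1 + z.2) by exact: add_continuous.
      apply: (cadd (t, 0)); rewrite /= addr0; apply: open_nbhs_nbhs; split => //.
      exact/EU/KE.
    by move=> [[A B] /= [At B0] AB]; exists (A, B) => // z [? ?]; exact: (AB z).
  move=> /nbhs_ballP[e /= e0 eK]; exists (e / 2); first by rewrite divr_gt0.
  move=> t tau Kt taue; apply: (eK tau) => //; rewrite /ball/= sub0r normrN.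
  by rewrite (le_lt_trans taue)// ltr_pdivrMr// ltr_pMr// ltr1n.
exists r => // tau taur.
have miUK : measurable_fun setT (\1_(U `\` K) : R -> R) by exact: measurable_indic.
have mt := measurable_translate tau miUK.
apply: (@le_trans _ _ (\int[mu]_t ((\1_(U `\` K) (t + tau) + \1_(U `\` K) t)%:E))%E).
  apply: integral_leE => //.
  - exact: ((measurable_EFinP _ _).1 (measurable_increment tau (measurable_indic mE))).
  - exact: measurable_funD.
  - move=> t; rewrite !indicE.
    have h1 : t \in E -> t + tau \notin E -> (t + tau \in U `\` K) || (t \in U `\` K).
      rewrite !inE => Et nEt; have [Kt|nKt] := pselect (K t).
        apply/orP; left; rewrite inE; split; first exact: Kr.
        by move=> Ktt; move: nEt; rewrite notin_setE; apply; exact: KE.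
      by apply/orP; right; rewrite inE; split=> //; exact: EU.
    have h2 : t + tau \in E -> t \notin E -> (t + tau \in U `\` K) || (t \in U `\` K).
      rewrite !inE => Et nEt; have [Kt|nKt] := pselect (K (t + tau)).
        apply/orP; right; rewrite inE; split.
          by rewrite -(addrK tau t); apply: Kr => //; rewrite normrN.
        by move=> Ktt; move: nEt; rewrite notin_setE; apply; exact: KE.
      by apply/orP; left; rewrite inE; split=> //; exact: EU.
    case: (t \in E) h1 h2 => h1 h2; case: (t + tau \in E) h1 h2 => h1 h2;
      rewrite ?subrr ?normr0 ?addr_ge0//.
      rewrite sub0r normrN normr1; have /orP[->|->] := h1 isT isT; by rewrite ?lerDl ?lerDr.
    rewrite subr0 normr1; have /orP[->|->] := h2 isT isT; by rewrite ?lerDl ?lerDr.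
rewrite integral_addE//.
rewrite (ge0_integral_shift tau (f := fun t => (\1_(U `\` K) t)%:E)
  ((measurable_EFinP _ _).2 miUK) (fun t => _)) ?lee_fin//.
by rewrite integral_indic// setIT [delta]splitr EFinD leeD.
Qed.

Lemma L1_translation_approx F : measurable_fun setT F ->
  (forall delta, 0 < delta -> exists G, [/\ measurable_fun setT G,
     L1_translation_continuous G &
     (\int[mu]_t `|F t - G t|%:E <= delta%:E)%E]) ->
  L1_translation_continuous F.
Proof.
move=> mF apx delta delta0.
have d3 : 0 < delta / 3 by rewrite divr_gt0.
have [G [mG cG FG]] := apx _ d3; have [r r0 H] := cG _ d3.
exists r => // tau taur.
have mFG : measurable_fun setT (fun t => `|F t - G t|).
  by apply: measurableT_comp => //; exact: measurable_funB.
have mFGt := measurable_translate tau mFG.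
have mi H (mH : measurable_fun setT H) := (measurable_EFinP _ _).1 (measurable_increment tau mH).
apply: (@le_trans _ _ (\int[mu]_t ((`|F (t + tau)%R - G (t + tau)%R| +
   `|F t - G t|) + `|G (t + tau)%R - G t|)%:E)%E).
  apply: integral_leE => //; first exact: mi.
    by apply: measurable_funD; [exact: measurable_funD|exact: mi].
  move=> t; have -> : F (t + tau) - F t = (F (t + tau) - G (t + tau)) + (G t - F t)
    + (G (t + tau) - G t) by ring.
  rewrite (le_trans (ler_normD _ _))// lerD2r (le_trans (ler_normD _ _))//.
  by rewrite lerD2l distrC.
have mG' := mi _ mG; have mFF := measurable_funD mFGt mFG.
rewrite integral_addE//.
rewrite integral_addE//.
rewrite (ge0_integral_shift tau (f := fun t => `|F t - G t|%:E)
  ((measurable_EFinP _ _).2 mFG) (fun t => _)) ?lee_fin//.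
have -> : delta = delta / 3 + delta / 3 + delta / 3 by field.
by rewrite 2!EFinD leeD// ?leeD// H.
Qed.

(** Simple functions are dense in [L^1], and for them the claim is additive in
    the level sets. *)
Lemma L1_translation F : mu.-integrable setT (EFin \o F) ->
  L1_translation_continuous F.
Proof.
move=> iF; have mF : measurable_fun setT F.
  exact: ((measurable_EFinP _ _).1 (measurable_int _ iF)).
apply: L1_translation_approx => // delta delta0.
have [s [si _ sF]] := approximation_sfun_integrable measurableT iF.
have {}sF : (fun n => fine (\int[mu]_z `|(EFin \o F) z - (s n z)%:E|)%E) @ \oo --> (0 : R).
  exact: (fine_cvg sF).
have [N _ HN] := cvgr_lt _ sF _ delta0.
have {HN} := HN N (leqnn N); set h := s N => hd.
have ih : mu.-integrable setT (EFin \o h) by exact: si.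
have mh : measurable_fun setT h by exact: ((measurable_EFinP _ _).1 (measurable_int _ ih)).
exists h; split => //; last first.
  have iB := integrable_abse (integrableB measurableT iF ih).
  rewrite -[X in (X <= _)%E]fineK; last exact: (integrable_fin_num measurableT iB).
  by rewrite lee_fin ltW.
have -> : (h : R -> R) = fun t => \sum_(c <- finmap.enum_fset (fset_set (range h)))
   (c * \1_(h @^-1` [set c]) t).
  by apply/funext => t; rewrite fimfunE fsbig_finite.
apply: L1_translation_sum => c.
have mE : measurable (h @^-1` [set c]) by rewrite -[X in measurable X]setTI; exact: mh.
split; first by apply: measurable_funM => //; exact: measurable_indic.
have [->|c0] := eqVneq (c) 0.
  under eq_fun do rewrite mul0r.
  exact: L1_translation0.
apply: L1_translationZ; first exact: measurable_indic.
apply: L1_translation_indic => //.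
have habs : (\int[mu]_t (`|c| * \1_(h @^-1` [set c]) t)%:E < +oo)%E.
  apply: le_lt_trans (integrable_nonneg_lty (integrable_norm ih)).
  apply: integral_leE => //.
  - by apply: measurable_funM => //; exact: measurable_indic.
  - move=> t /=; rewrite indicE; have [|_] := boolP (t \in _).
      by rewrite inE/= => ->; rewrite mulr1.
    by rewrite mulr0.
move: habs; rewrite integral_scaleE//.
rewrite integral_indic// setIT => h1.
rewrite ltNge; apply/negP => h2; move: h1.
have h3 : mu (h @^-1` [set c]) = +oo%E by apply/eqP; rewrite eq_le leey h2.
rewrite [X in (_ * X < _)%E]h3.
by rewrite gt0_muley ?ltxx// lte_fin normr_gt0.
Qed.

End TranslationL1.

(** * Square-integrable functions and their correlations *)

Section SquareIntegrable.
Context {R : realType}.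
Implicit Types (f g h m : R -> R[i]).
Local Notation mu := (@lebesgue_measure R).
Local Notation N2 f := (\int[mu]_t normc (f t) ^+ 2).

Lemma sqr_Lnorm2 (phi : R -> R) : (forall t, 0 <= phi t) ->
  ('N[mu]_(2%:E)[EFin \o phi] `^ 2 = \int[mu]_t (phi t ^+ 2)%:E)%E.
Proof.
move=> phi0; rewrite powR_Lnorm//; apply: eq_integral => t _ /=.
by rewrite ger0_norm// powR_mulrn.
Qed.

Lemma L2P f : L2 f <->
  Cmeas f /\ (\int[mu]_t (normc (f t) ^+ 2)%:E < +oo)%E.
Proof.
have E := sqr_Lnorm2 (fun t => normc_ge0 (f t)).
split => [[mf1 mf2 foo]|[[mf1 mf2] foo]]; split => //.
  by rewrite -E; exact: poweR_lty.
by move: foo; rewrite -E => /lty_poweRy; apply.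
Qed.

Lemma L2_Cmeas f : L2 f -> Cmeas f. Proof. by move=> /L2P[]. Qed.

Lemma measurable_sqr_normc f : Cmeas f ->
  measurable_fun setT (fun t => normc (f t) ^+ 2).
Proof. by move=> mf; apply: measurable_funX; exact: Cmeas_normc. Qed.

Lemma L2_integrable f : L2 f ->
  mu.-integrable setT (EFin \o (fun t => normc (f t) ^+ 2)).
Proof.
move=> /L2P[mf foo]; apply: integrable_nonneg => //.
  exact: measurable_sqr_normc.
by move=> t; rewrite sqr_ge0.
Qed.

Lemma L2norm_sqr f : L2 f -> L2norm f ^+ 2 = N2 f.
Proof.
move=> lf; have E := sqr_Lnorm2 (fun t => normc_ge0 (f t)).
rewrite /Rintegral -E /L2norm.
case: lf => _ _; rewrite /finite_norm.
have := Lnorm_ge0 mu 2%:E (EFin \o (fun t => normc (f t))).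
by case: (Lnorm _ _ _) => [r| |]//=; rewrite lee_fin => r0 _; rewrite powR_mulrn.
Qed.

Lemma N2_ge0 f : 0 <= N2 f.
Proof. by apply: Rintegral_ge0 => t _; rewrite sqr_ge0. Qed.

Lemma L2_dom f h C : Cmeas f -> L2 h ->
  (forall t, normc (f t) <= C * normc (h t)) -> L2 f.
Proof.
move=> mf lh fh; apply/L2P; split => //.
have ih := integrableZl measurableT (C ^+ 2) (L2_integrable lh).
have ioo := integrable_nonneg_lty (mu := mu) (F := fun t => C ^+ 2 * normc (h t) ^+ 2) ih.
apply: (le_lt_trans _ ioo).
apply: integral_leE.
- exact: measurable_sqr_normc.
- by apply: measurable_funM => //; by apply: measurable_sqr_normc; exact: L2_Cmeas.
- by move=> t; rewrite sqr_ge0.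
- by move=> t; rewrite -exprMn lerXn2r// ?nnegrE ?normc_ge0// (le_trans _ (fh t)) ?normc_ge0.
Qed.

Lemma L2_mul_bounded m f C : Cmeas m -> (forall t, normc (m t) <= C) -> L2 f ->
  L2 (fun t => m t * f t).
Proof.
move=> mm mC lf; apply: (L2_dom (h := f) (C := C)) => //.
  by apply: CmeasM => //; exact: L2_Cmeas.
by move=> t; rewrite normcMr ler_wpM2r// normc_ge0.
Qed.

Lemma L2_conj f : L2 f -> L2 (fun t => conjc (f t)).
Proof.
move=> lf; apply: (L2_dom (h := f) (C := 1)) => //.
  by apply: Cmeas_conj; exact: L2_Cmeas.
by move=> t; rewrite normc_conj mul1r.
Qed.

Lemma L2D f h : L2 f -> L2 h -> L2 (fun t => f t + h t).
Proof.
move=> lf lh; apply/L2P; split; first by apply: CmeasD; exact: L2_Cmeas.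
have i1 := integrableZl measurableT 2 (L2_integrable lf).
have i2 := integrableZl measurableT 2 (L2_integrable lh).
have i12 := integrableD measurableT i1 i2.
have ioo := integrable_nonneg_lty (mu := mu)
  (F := fun t => 2 * normc (f t) ^+ 2 + 2 * normc (h t) ^+ 2) i12.
apply: (le_lt_trans _ ioo).
apply: integral_leE.
- by apply: measurable_sqr_normc; apply: CmeasD; exact: L2_Cmeas.
- apply: measurable_funD; apply: measurable_funM => //;
    by apply: measurable_sqr_normc; exact: L2_Cmeas.
- by move=> t; rewrite sqr_ge0.
- move=> t; apply: (@le_trans _ _ ((normc (f t) + normc (h t)) ^+ 2)).
    by rewrite lerXn2r// ?nnegrE ?addr_ge0 ?normc_ge0// le_normc_add.
  by have := sqr_ge0 (normc (f t) - normc (h t)); nra.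
Qed.

Lemma L2Z (c : R[i]) f : L2 f -> L2 (fun t => c * f t).
Proof.
by move=> lf; apply: (L2_mul_bounded (C := normc c)) => //; exact: Cmeas_cst.
Qed.

Lemma L2B f h : L2 f -> L2 h -> L2 (fun t => f t - h t).
Proof.
move=> lf lh; rewrite (_ : (fun _ => _) = (fun t => f t + (-1) * h t)).
  exact/L2D/L2Z.
by apply/funext => t; rewrite mulN1r.
Qed.

Lemma L2_translate f a : L2 f -> L2 (fun t => f (t + a)).
Proof.
move=> lf; have /L2P[mf foo] := lf; apply/L2P; split.
  exact: (Cmeas_comp (measurable_shift a) mf).
rewrite (ge0_integral_shift a (f := fun t => (normc (f t) ^+ 2)%:E))//.
  by apply/measurable_EFinP; exact: measurable_sqr_normc.
by move=> t; rewrite lee_fin sqr_ge0.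
Qed.

Lemma L2_reflect f a : L2 f -> L2 (fun t => f (a - t)).
Proof.
move=> lf; have /L2P[mf foo] := lf; apply/L2P; split.
  exact: (Cmeas_comp (measurable_reflect a) mf).
rewrite (ge0_integral_reflect a (f := fun t => (normc (f t) ^+ 2)%:E))//.
  by apply/measurable_EFinP; exact: measurable_sqr_normc.
by move=> t; rewrite lee_fin sqr_ge0.
Qed.

Lemma N2_translate f a : Cmeas f -> N2 (fun t => f (t + a)) = N2 f.
Proof.
move=> mf; congr fine.
rewrite (ge0_integral_shift a (f := fun t => (normc (f t) ^+ 2)%:E))//.
  by apply/measurable_EFinP; exact: measurable_sqr_normc.
by move=> t; rewrite lee_fin sqr_ge0.
Qed.

Lemma N2_reflect f a : Cmeas f -> N2 (fun t => f (a - t)) = N2 f.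
Proof.
move=> mf; congr fine.
rewrite (ge0_integral_reflect a (f := fun t => (normc (f t) ^+ 2)%:E))//.
  by apply/measurable_EFinP; exact: measurable_sqr_normc.
by move=> t; rewrite lee_fin sqr_ge0.
Qed.

(** With the weight left free, this does the work of the Cauchy-Schwarz
    inequality. *)
Lemma young_product (lambda a b : R) : 0 < lambda ->
  a * b <= (lambda * a ^+ 2 + lambda^-1 * b ^+ 2) / 2.
Proof.
move=> l0; rewrite ler_pdivlMr//.
have -> : lambda * a ^+ 2 + lambda^-1 * b ^+ 2 =
    a * b * 2 + lambda^-1 * (lambda * a - b) ^+ 2.
  by field; rewrite gt_eqF.
by rewrite lerDl mulr_ge0 ?sqr_ge0// invr_ge0 ltW.
Qed.

Lemma integral_young f h (lambda : R) : L2 f -> L2 h -> 0 < lambda ->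
  (\int[mu]_t (normc (f t) * normc (h t))%:E <=
   ((lambda * N2 f + lambda^-1 * N2 h) / 2)%:E)%E.
Proof.
move=> lf lh l0; have l0' : 0 < lambda^-1 by rewrite invr_gt0.
have i1 := integrableZl measurableT (lambda / 2) (L2_integrable lf).
have i2 := integrableZl measurableT (lambda^-1 / 2) (L2_integrable lh).
have -> : (lambda * N2 f + lambda^-1 * N2 h) / 2 =
    \int[mu]_t (lambda / 2 * normc (f t) ^+ 2 + lambda^-1 / 2 * normc (h t) ^+ 2).
  rewrite RintegralD// !RintegralZl//; try exact: L2_integrable.
  by field; rewrite gt_eqF.
rewrite Rintegral_EFin; last first.
  have := integrableD measurableT i1 i2; exact.
apply: integral_leE.
- by apply: measurable_funM; by apply: Cmeas_normc; exact: L2_Cmeas.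
- apply: measurable_funD; apply: measurable_funM => //;
    by apply: measurable_sqr_normc; exact: L2_Cmeas.
- by move=> t; rewrite mulr_ge0 ?normc_ge0.
- move=> t; rewrite (le_trans (young_product _ _ l0))// le_eqVlt.
  by apply/orP; left; apply/eqP; field; rewrite gt_eqF.
Qed.

Lemma L2_Cintegrable f h : L2 f -> L2 h -> Cintegrable mu (fun t => f t * h t).
Proof.
move=> lf lh; apply: Cintegrable_lty; first by apply: CmeasM; exact: L2_Cmeas.
under eq_integral do rewrite normcMr.
by rewrite (le_lt_trans (integral_young lf lh ltr01))// ltry.
Qed.

Lemma L2_Cintegrable_conj f h : L2 f -> L2 h ->
  Cintegrable mu (fun t => f t * conjc (h t)).
Proof. by move=> lf lh; apply: L2_Cintegrable => //; exact: L2_conj. Qed.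

Lemma normc_inner_young f h (lambda : R) : L2 f -> L2 h -> 0 < lambda ->
  normc (inner f h) <= (lambda * N2 f + lambda^-1 * N2 h) / 2.
Proof.
move=> lf lh l0; have ifh := L2_Cintegrable_conj lf lh.
rewrite (le_trans (le_normc_Cintegral ifh))//.
rewrite -lee_fin Rintegral_EFin; last exact: Cintegrable_normc.
apply: le_trans (integral_young lf lh l0).
by under eq_integral do rewrite normcMr normc_conj.
Qed.

Lemma inner_self f : L2 f -> inner f f = real_complex R (N2 f).
Proof.
move=> lf; apply: complex_ext => /=.
  by congr Rintegral; apply/funext => t; rewrite mulc_conj.
rewrite /Rintegral integral0_eq// => t _; rewrite mulc_conj//.
Qed.

Lemma inner_conj f h : L2 f -> L2 h -> conjc (inner f h) = inner h f.
Proof.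
move=> lf lh; rewrite -Cintegral_conj; last exact: L2_Cintegrable_conj.
by congr Cintegral; apply/funext => t; rewrite conjcM conjcK mulrC.
Qed.

(** The signed square [x |x|] turns square-integrable increments into
    integrable ones. *)
Lemma sqr_increment_le (a b : R) :
  (a - b) ^+ 2 <= 2 * `|a * `|a| - b * `|b| |.
Proof.
wlog ab : a b / b <= a.
  move=> W; have [|/ltW ab] := leP b a; first exact: W.
  by rewrite -sqrrN opprB -normrN opprB; exact: W.
have d0 : 0 <= a - b by rewrite subr_ge0.
case: (ger0P a) => a0; case: (ger0P b) => b0.
- have h1 := mulr_ge0 d0 a0; have h2 := mulr_ge0 d0 b0.
  by rewrite ger0_norm; nra.
- have h1 := sqr_ge0 a; have h2 := sqr_ge0 b; have h3 := sqr_ge0 (a + b).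
  by rewrite ger0_norm; nra.
- by have := lt_le_trans a0 b0; rewrite ltNge ab.
- have h1 := mulr_ge0 d0 (ltW (etrans (oppr_gt0 a) a0)).
  have h2 := mulr_ge0 d0 (ltW (etrans (oppr_gt0 b) b0)).
  by rewrite ger0_norm; nra.
Qed.

Lemma real_L2_translation (phi : R -> R) : measurable_fun setT phi ->
  mu.-integrable setT (EFin \o (fun t => phi t ^+ 2)) ->
  forall delta, 0 < delta -> exists2 r, 0 < r & forall tau, `|tau| <= r ->
    (\int[mu]_t ((phi (t + tau) - phi t) ^+ 2)%:E <= delta%:E)%E.
Proof.
move=> mphi iphi delta delta0.
have mF : measurable_fun setT (fun t => phi t * `|phi t|).
  by apply: measurable_funM => //; exact: measurableT_comp.
have iF : mu.-integrable setT (EFin \o (fun t => phi t * `|phi t|)).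
  apply: (le_integrable measurableT _ _ iphi); first exact/measurable_EFinP.
  by move=> t _ /=; rewrite lee_fin normrX normrM normr_id expr2.
have d2 : 0 < delta / 2 by rewrite divr_gt0.
have [r r0 H] := L1_translation iF d2.
exists r => // tau taur.
apply: (@le_trans _ _ (2%:E * (delta / 2)%:E)%E); last first.
  by rewrite -EFinM lee_fin mulrC divfK.
apply: le_trans (lee_wpmul2l _ (H _ taur)); last by rewrite lee_fin.
have mF' : measurable_fun setT (fun t : R => `|phi (t + tau) * `|phi (t + tau)| - phi t * `|phi t| |).
  exact: ((measurable_EFinP _ _).1 (measurable_increment tau mF)).
rewrite -integral_scaleE//; apply: integral_leE.
- apply: measurable_funX; apply: measurable_funB => //.
  exact: (measurable_translate tau mphi).
- exact: measurable_funM.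
- by move=> t; rewrite sqr_ge0.
- by move=> t; exact: sqr_increment_le.
Qed.

(** The two components are treated separately. *)
Lemma L2_translation f : L2 f -> forall delta, 0 < delta ->
  exists2 r, 0 < r & forall tau, `|tau| <= r ->
    N2 (fun t => f (t + tau) - f t) <= delta.
Proof.
move=> lf delta delta0; have [mf1 mf2] := L2_Cmeas lf.
have iRe : mu.-integrable setT (EFin \o (fun t => complex.Re (f t) ^+ 2)).
  apply: (le_integrable measurableT _ _ (L2_integrable lf)).
    by apply/measurable_EFinP; apply: measurable_funX.
  move=> t _ /=; rewrite lee_fin !ger0_norm ?sqr_ge0// sqr_normcE.
  by rewrite lerDl sqr_ge0.
have iIm : mu.-integrable setT (EFin \o (fun t => complex.Im (f t) ^+ 2)).
  apply: (le_integrable measurableT _ _ (L2_integrable lf)).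
    by apply/measurable_EFinP; apply: measurable_funX.
  move=> t _ /=; rewrite lee_fin !ger0_norm ?sqr_ge0// sqr_normcE.
  by rewrite lerDr sqr_ge0.
have d2 : 0 < delta / 2 by rewrite divr_gt0.
have [r1 r10 H1] := real_L2_translation mf1 iRe d2.
have [r2 r20 H2] := real_L2_translation mf2 iIm d2.
exists (Num.min r1 r2); first by rewrite lt_min r10.
move=> tau; rewrite le_min => /andP[t1 t2].
have ld : L2 (fun t => f (t + tau) - f t) by apply: L2B => //; exact: L2_translate.
rewrite -lee_fin Rintegral_EFin; last exact: L2_integrable.
rewrite [delta]splitr EFinD (le_trans _ (leeD (H1 _ t1) (H2 _ t2)))//.
rewrite -integral_addE.
- rewrite le_eqVlt; apply/orP; left; apply/eqP; apply: eq_integral => t _.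
  by rewrite sqr_normcE Re_addc Im_addc Re_oppc Im_oppc.
- apply: measurable_funX; apply: measurable_funB => //.
  exact: (measurable_translate tau mf1).
- apply: measurable_funX; apply: measurable_funB => //.
  exact: (measurable_translate tau mf2).
- by move=> t; rewrite sqr_ge0.
- by move=> t; rewrite sqr_ge0.
Qed.

(** The cross-correlation of [f] and [h]. *)
Definition correlation f h (tau : R) : R[i] := inner (fun t => f (t + tau)) h.

Lemma Cmeas_correlation f h : L2 f -> L2 h -> Cmeas (correlation f h).
Proof.
move=> lf lh; apply: (Cmeas_param mu
  (F := fun p : R * R => f (p.2 + p.1) * conjc (h p.2))).
apply: CmeasM.
  apply: (Cmeas_comp (phi := fun p : R * R => p.2 + p.1)); last exact: L2_Cmeas.
  by apply: measurable_funD.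
exact: (Cmeas_comp measurable_snd (Cmeas_conj (L2_Cmeas lh))).
Qed.

Lemma correlation_bounded f h tau : L2 f -> L2 h ->
  normc (correlation f h tau) <= (N2 f + N2 h) / 2.
Proof.
move=> lf lh.
have := normc_inner_young (L2_translate tau lf) lh ltr01.
by rewrite invr1 !mul1r N2_translate//; exact: L2_Cmeas.
Qed.

(** Only the increment of [f] enters, and translations are continuous in
    [L^2]. *)
Lemma correlation_continuous0 f h : L2 f -> L2 h -> forall delta, 0 < delta ->
  exists2 r, 0 < r & forall tau, `|tau| <= r ->
    normc (correlation f h tau - inner f h) <= delta.
Proof.
move=> lf lh delta delta0.
have h0 := N2_ge0 h; have h1 : 0 < N2 h + 1 by rewrite ltr_wpDl.
(* the weight for which the contribution of [h] is at most [delta] *)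
pose lambda := (N2 h + 1) / delta.
have l0 : 0 < lambda by rewrite divr_gt0.
have [r r0 H] := L2_translation lf (divr_gt0 delta0 l0).
exists r => // tau taur.
have ld : L2 (fun t => f (t + tau) - f t) by apply: L2B => //; exact: L2_translate.
have -> : correlation f h tau - inner f h = inner (fun t => f (t + tau) - f t) h.
  rewrite /correlation /inner -CintegralB.
  - by congr Cintegral; apply/funext => t; rewrite mulrBl.
  - by apply: L2_Cintegrable_conj => //; exact: L2_translate.
  - exact: L2_Cintegrable_conj.
rewrite (le_trans (normc_inner_young ld lh l0))// ler_pdivrMr// mulr_natr mulr2n.
apply: lerD.
  by rewrite mulrC -ler_pdivlMr//; exact: H.
rewrite /lambda invf_div mulrAC ler_pdivrMr// ler_pM2l//.
by rewrite lerDl.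
Qed.

End SquareIntegrable.

(** * The Poisson kernel *)

Section PoissonKernel.
Context {R : realType}.
Local Notation mu := (@lebesgue_measure R).
Implicit Types (eps s t x eta : R).

Definition damp eps eta : R := expR (- (eps * `|eta|)).

(** [2 pi] times the Poisson kernel of the upper half-plane at height [eps]; in
    this normalisation it is the Fourier transform of [damp eps]. *)
Definition poisson eps t : R := 2 * eps / (eps ^+ 2 + t ^+ 2).

Lemma integral_even_FTC (f g F : R -> R) (l : R) :
  (forall x, 0 <= f x) -> continuous f -> (forall x, f (- x) = f x) ->
  (forall x, is_derive x 1 F (g x)) -> (forall x, 0 <= x -> f x = g x) ->
  F x @[x --> +oo] --> l ->
  (\int[mu]_x (f x)%:E = (2 * (l - F 0))%:E)%E.
Proof.
move=> f0 cf fe dF fg Fl.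
have cF : continuous F.
  move=> x; apply: differentiable_continuous; apply/derivable1_diffP.
  by have [] := dF x.
rewrite ge0_symfun_integralT//; last by move=> x; rewrite /= fe.
rewrite EFinM; congr (_ * _)%E.
rewrite (_ : [set x | 0 <= x] = `[0, +oo[%classic); last by rewrite set_itvcy.
rewrite (@ge0_continuous_FTC2y _ f F 0 l)//.
- exact: continuous_subspaceT.
- by apply: cvg_at_right_filter; exact: cF.
- move=> x; rewrite in_itv/= andbT => x0; rewrite derive1E fg ?ltW//.
  by have [_] := dF x.
Qed.

Lemma is_derive_lin (c x : R) : is_derive x 1 (fun t : R => c * t) c.
Proof.
have h := @is_deriveZ R R^o R^o id c x 1 1 (is_derive_id _ _).
by apply: is_derive_eq h _; rewrite /GRing.scale/= mulr1.
Qed.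

Lemma cvg_expRNM eps : 0 < eps -> expR (- (eps * x)) @[x --> +oo] --> (0:R).
Proof.
move=> e0.
rewrite (_ : (fun x => expR (- (eps * x))) =
  (fun z => expR (- z)) \o (fun z => eps * z))//.
apply: (@cvg_comp _ _ _ _ _ _ (pinfty_nbhs R)); last exact: cvgr_expR.
exact: gt0_cvgMry.
Qed.

Lemma continuous_damp eps : continuous (damp eps).
Proof.
move=> x; apply: continuous_comp; last exact: continuous_expR.
apply: continuousN; apply: continuousM; first exact: cst_continuous.
exact: norm_continuous.
Qed.

Lemma measurable_damp eps : measurable_fun setT (damp eps).
Proof. by apply: continuous_measurable_fun; exact: continuous_damp. Qed.

Lemma damp_ge0 eps eta : 0 <= damp eps eta. Proof. exact: expR_ge0. Qed.

Lemma damp_le1 eps eta : 0 <= eps -> damp eps eta <= 1.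
Proof. by move=> e0; rewrite -expR0 ler_expR oppr_le0 mulr_ge0. Qed.

Lemma poisson_ge0 eps t : 0 < eps -> 0 <= poisson eps t.
Proof.
by move=> e0; rewrite divr_ge0 ?mulr_ge0 ?(ltW e0)// addr_ge0// sqr_ge0.
Qed.

Lemma poisson_den_gt0 eps t : 0 < eps -> 0 < eps ^+ 2 + t ^+ 2.
Proof. by move=> e0; rewrite ltr_pwDl ?exprn_gt0// sqr_ge0. Qed.

Lemma poissonN eps t : poisson eps (- t) = poisson eps t.
Proof. by rewrite /poisson sqrrN. Qed.

(** The antiderivative is read off from that of the complex exponential;
    the summand 1 keeps the integrand nonnegative. *)
Lemma integral_damp_1cos eps s : 0 < eps ->
  (\int[mu]_eta (damp eps eta * (1 + cos (s * eta)))%:E =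
   (2 / eps + poisson eps s)%:E)%E.
Proof.
move=> e0; have d0 := poisson_den_gt0 s e0.
(* real part of [exp((- eps + i s) x) / (- eps + i s)], plus the
   antiderivative of [exp(- eps x)] *)
pose a := - eps / (eps ^+ 2 + s ^+ 2); pose b := s / (eps ^+ 2 + s ^+ 2).
pose B x := - eps^-1 + (a * cos (s * x) + b * sin (s * x)).
pose F x := expR (- eps * x) * B x.
transitivity ((2 * (0 - F 0))%:E); last first.
  congr EFin; rewrite /F /B !mulr0 expR0 cos0 sin0 mulr0 addr0 /a /poisson.
  by field; rewrite !gt_eqF.
apply: (@integral_even_FTC (fun x => damp eps x * (1 + cos (s * x)))
   (fun x => expR (- eps * x) * (1 + cos (s * x))) F 0).
- by move=> x; rewrite mulr_ge0 ?damp_ge0// -lerBlDl sub0r cos_geN1.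
- move=> x; apply: continuousM; first exact: continuous_damp.
  apply: continuousD; first exact: cst_continuous.
  apply: continuous_comp; last exact: continuous_cos.
  by apply: continuousM; [exact: cst_continuous|exact: cvg_id].
- by move=> x; rewrite /damp normrN mulrN cosN.
- move=> x.
  have dE : is_derive x 1 (fun x => expR (- eps * x)) (expR (- eps * x) * (- eps)).
    exact: is_derive1_comp (is_derive_expR _) (is_derive_lin _ _).
  have dC : is_derive x 1 (fun x => cos (s * x)) (- sin (s * x) * s).
    exact: is_derive1_comp (is_derive_cos _) (is_derive_lin _ _).
  have dS : is_derive x 1 (fun x => sin (s * x)) (cos (s * x) * s).
    exact: is_derive1_comp (is_derive_sin _) (is_derive_lin _ _).
  have daC := is_derive1_comp (is_derive_lin a _) dC.
  have dbS := is_derive1_comp (is_derive_lin b _) dS.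
  have dB := is_deriveD (is_derive_cst (- eps^-1) x 1) (is_deriveD daC dbS).
  have dF := is_deriveM dE dB.
  apply: is_derive_eq dF _; rewrite /GRing.scale/= !fctE/= /a /b.
  by field; rewrite !gt_eqF.
- by move=> x x0; rewrite /damp ger0_norm// mulNr.
- (* [B] is bounded by [C], so [F] decays like the exponential *)
  pose C := eps^-1 + (`|a| + `|b|).
  have CE : C * expR (- (eps * x)) @[x --> +oo] --> (0 : R).
    rewrite -(mulr0 C); apply: cvgM; [exact: cvg_cst|exact: cvg_expRNM].
  apply/norm_cvg0P; apply: (@squeeze_cvgr _ _ _ _ (cst 0) (fun x => C * expR (- (eps * x)))) => //;
      last exact: cvg_cst.
  apply: nearW => x; rewrite /= normr_ge0/= /F normrM mulrC mulNr.
  rewrite (ger0_norm (expR_ge0 _)) ler_wpM2r ?expR_ge0//.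
  rewrite (le_trans (ler_normD _ _))// normrN ger0_norm ?invr_ge0 ?(ltW e0)// lerD2l.
  rewrite (le_trans (ler_normD _ _))// !normrM lerD// ler_piMr//.
    by rewrite ler_norml cos_geN1 cos_le1.
  by rewrite ler_norml sin_geN1 sin_le1.
Qed.

Lemma integrable_damp eps : 0 < eps -> mu.-integrable setT (EFin \o damp eps).
Proof.
move=> e0; apply: integrable_nonneg; [exact: measurable_damp|exact: damp_ge0|].
apply: (@le_lt_trans _ _ (\int[mu]_eta (damp eps eta * (1 + cos (0 * eta)))%:E)%E);
    last by rewrite integral_damp_1cos// ltry.
apply: integral_leE => //; first exact: measurable_damp.
- under eq_fun do rewrite mul0r cos0.
  by apply: measurable_funM => //; exact: measurable_damp.
- by move=> t; exact: damp_ge0.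
- by move=> t; rewrite mul0r cos0 ler_peMr ?damp_ge0// lerDl.
Qed.

Lemma integral_damp eps : 0 < eps -> \int[mu]_eta damp eps eta = 2 / eps.
Proof.
move=> e0; have := integral_damp_1cos 0 e0; rewrite /poisson.
under eq_integral do rewrite mul0r cos0 mulrC.
rewrite integral_scaleE//; [|exact: measurable_damp|by move=> t; exact: damp_ge0].
rewrite -Rintegral_EFin; last exact: integrable_damp.
rewrite -EFinM => -[]; rewrite expr0n/= addr0 => H.
have : (1 + 1) * \int[mu]_eta damp eps eta = (1 + 1) * (2 / eps).
  by rewrite H; field; rewrite gt_eqF.
by apply: mulfI.
Qed.

Lemma measurable_expi s : Cmeas (fun eta : R => expi (eta * s)).
Proof.
have ms : continuous (fun eta : R => eta * s).
  by move=> x; apply: continuousM; [exact: cvg_id|exact: cst_continuous].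
by split; apply: continuous_measurable_fun => x; apply: continuous_comp;
  [exact: ms|exact: continuous_cos|exact: ms|exact: continuous_sin].
Qed.

Lemma normc_expi s : normc (expi s) = 1.
Proof. by rewrite normcE2/= cos2Dsin2 sqrtr1. Qed.

Lemma expiD s t : expi (s + t) = expi s * expi t.
Proof.
apply: complex_ext; rewrite ?Re_mulc ?Im_mulc/= ?cosD ?sinD//.
by rewrite addrC.
Qed.

Lemma conjc_expi s : conjc (expi s) = expi (- s).
Proof. by apply: complex_ext; rewrite ?Re_conjc ?Im_conjc/= ?cosN ?sinN. Qed.

Lemma Cintegrable_damp_expi eps s : 0 < eps ->
  Cintegrable mu (fun eta => real_complex R (damp eps eta) * expi (eta * s)).
Proof.
move=> e0; apply: (Cintegrable_dom _ _ (integrable_damp e0)).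
  apply: CmeasM; last exact: measurable_expi.
  by apply: Cmeas_real; exact: measurable_damp.
by move=> t; rewrite normcMr normc_expi mulr1 normc_nneg// damp_ge0.
Qed.

(** The real part follows from the integrals with and without the cosine; the
    imaginary part is the integral of an odd function. *)
Lemma Cintegral_damp_expi eps s : 0 < eps ->
  Cintegral mu (fun eta => real_complex R (damp eps eta) * expi (eta * s)) =
  real_complex R (poisson eps s).
Proof.
move=> e0; have [iR iI] := Cintegrable_damp_expi s e0.
apply: complex_ext => /=.
  have <- : (\int[mu]_eta (damp eps eta * (1 + cos (s * eta)))) - 2 / eps = poisson eps s.
    by rewrite /Rintegral integral_damp_1cos//=; ring.
  rewrite -integral_damp// -RintegralB//; last exact: integrable_damp.
    by congr Rintegral; apply/funext => t; rewrite /= mul0r subr0 mulrDr mulr1 addrAC subrr add0r (mulrC s).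
  have := integrableD measurableT (integrable_damp e0) iR.
  apply: eq_integrable => // t _; rewrite /= mul0r subr0 -EFinD mulrDr mulr1.
  by rewrite (mulrC s).
set I := Rintegral _ _ _; have : I = - I.
  rewrite {1}/I /Rintegral.
  rewrite -(integral_reflect 0); last exact: measurable_int iI.
  rewrite -mulN1r -RintegralZl//; congr fine; apply: eq_integral => t _.
  by rewrite /= !mul0r !addr0 /damp sub0r normrN mulNr sinN mulrN mulN1r.
move=> h; apply/eqP; have := subrr I; rewrite {2}h opprK -mulr2n -mulr_natl => /eqP.
by rewrite mulf_eq0 pnatr_eq0.
Qed.

Lemma continuous_poisson eps : 0 < eps -> continuous (poisson eps).
Proof.
move=> e0 x; apply: (@continuousM _ _ (cst (2 * eps))
  (fun t : R => (eps ^+ 2 + t ^+ 2)^-1)); first exact: cst_continuous.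
apply: continuousV; first by rewrite gt_eqF// poisson_den_gt0.
apply: continuousD; first exact: cst_continuous.
exact: exprn_continuous.
Qed.

Lemma measurable_poisson eps : 0 < eps -> measurable_fun setT (poisson eps).
Proof. by move=> e0; apply: continuous_measurable_fun; exact: continuous_poisson. Qed.

Lemma integral_poisson eps : 0 < eps ->
  (\int[mu]_t (poisson eps t)%:E = (2 * pi)%:E)%E.
Proof.
move=> e0; pose F x := 2 * atan (eps^-1 * x).
transitivity ((2 * (pi - F 0))%:E); last first.
  by congr EFin; rewrite /F mulr0 atan0 mulr0 subr0.
apply: (@integral_even_FTC (poisson eps) (poisson eps) F pi).
- by move=> x; exact: poisson_ge0.
- exact: continuous_poisson.
- exact: poissonN.
- move=> x.
  have dA := is_derive1_comp (is_derive1_atan (eps^-1 * x)) (is_derive_lin eps^-1 x).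
  have dF := is_derive1_comp (is_derive_lin 2 _) dA.
  apply: is_derive_eq dF _; rewrite /poisson.
  by field; rewrite !gt_eqF ?poisson_den_gt0.
- by [].
- rewrite (_ : pi = 2 * (pi / 2)); last by field.
  apply: cvgM; first exact: cvg_cst.
  apply: (@cvg_comp _ _ _ (fun x => eps^-1 * x) (@atan R) _ (pinfty_nbhs R)).
    by apply: gt0_cvgMry => //; rewrite invr_gt0.
  exact: cvgy_atan.
Qed.

Lemma integrable_poisson eps : 0 < eps -> mu.-integrable setT (EFin \o poisson eps).
Proof.
move=> e0; apply: integrable_nonneg.
- exact: measurable_poisson.
- by move=> t; exact: poisson_ge0.
- by rewrite integral_poisson// ltry.
Qed.

Lemma poisson_le eps t : 0 < eps -> poisson eps t <= 2 / eps.
Proof.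
move=> e0; rewrite ler_pdivrMr ?poisson_den_gt0//.
have -> : 2 / eps * (eps ^+ 2 + t ^+ 2) = 2 * eps + 2 / eps * t ^+ 2.
  by field; rewrite gt_eqF.
by rewrite lerDl mulr_ge0 ?sqr_ge0// divr_ge0// ltW.
Qed.

Lemma poisson_le_tail eps t : 0 < eps -> t != 0 -> poisson eps t <= 2 * eps / t ^+ 2.
Proof.
move=> e0 t0; rewrite /poisson ler_wpM2l ?mulr_ge0 ?(ltW e0)//.
rewrite lef_pV2 ?posrE ?poisson_den_gt0//; last by rewrite exprn_even_gt0.
by rewrite lerDr sqr_ge0.
Qed.

End PoissonKernel.

(** * Approximate identities at Lebesgue points *)

Section ApproximateIdentity.
Context {R : realType}.
Local Notation mu := (@lebesgue_measure R).
Local Notation I_ r := (\1_(ball (0 : R) r) : R -> R).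
Implicit Types (eps t r delta : R).

Lemma measurable_ball_indic r : measurable_fun setT (I_ r).
Proof. by apply: measurable_indic; exact: measurable_ball. Qed.

Lemma ball_indicE r t : I_ r t = (`|t| < r)%R%:R.
Proof.
rewrite indicE; congr (nat_of_bool _)%:R.
by apply/idP/idP; rewrite inE /ball/= sub0r normrN.
Qed.

Lemma poisson_le_scale eps t : 0 < eps ->
  poisson eps t <= (eps + eps^-1) * poisson 1 t.
Proof.
move=> e0; rewrite -subr_ge0 /poisson.
have d1 : 0 < 1 ^+ 2 + t ^+ 2 by exact: poisson_den_gt0.
have d2 := poisson_den_gt0 t e0.
have -> : (eps + eps^-1) * (2 * 1 / (1 ^+ 2 + t ^+ 2)) - 2 * eps / (eps ^+ 2 + t ^+ 2)
   = 2 * (eps ^+ 3 + eps^-1 * t ^+ 2) / ((1 ^+ 2 + t ^+ 2) * (eps ^+ 2 + t ^+ 2)).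
  by field; rewrite !gt_eqF// -?[X in X + _](expr1n _ 2).
have e1 := ltW e0; have i1 : 0 <= eps^-1 by rewrite invr_ge0.
apply: divr_ge0; apply: mulr_ge0; rewrite ?(ltW d1) ?(ltW d2)//.
by rewrite addr_ge0 ?exprn_ge0// mulr_ge0// sqr_ge0.
Qed.

Lemma poisson_le_far eps r t : 0 < eps -> 0 < r -> r <= `|t| ->
  poisson eps t <= eps * (1 + (r ^+ 2)^-1) * poisson 1 t.
Proof.
move=> e0 r0 rt.
have rt2 : r ^+ 2 <= t ^+ 2 by rewrite -(real_normK (num_real t)) lerXn2r ?nnegrE// ltW.
have r2 : 0 < r ^+ 2 by rewrite exprn_gt0.
have t2 : 0 < t ^+ 2 by rewrite (lt_le_trans r2).
have t0 : t != 0 by rewrite -sqrf_eq0 gt_eqF.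
rewrite (le_trans (poisson_le_tail e0 t0))// -subr_ge0 /poisson.
have d1 : 0 < 1 ^+ 2 + t ^+ 2 by exact: poisson_den_gt0.
have -> : eps * (1 + (r ^+ 2)^-1) * (2 * 1 / (1 ^+ 2 + t ^+ 2)) - 2 * eps / t ^+ 2
   = 2 * eps * (t ^+ 2 - r ^+ 2) / (r ^+ 2 * t ^+ 2 * (1 ^+ 2 + t ^+ 2)).
  by rewrite expr1n in d1 *; field; rewrite t0 !gt_eqF.
apply: divr_ge0; first by rewrite mulr_ge0 ?subr_ge0// mulr_ge0// ltW.
by apply: mulr_ge0; [apply: mulr_ge0; exact: sqr_ge0|exact: ltW].
Qed.

(** Dyadic bound: on the annulus [2^N eps <= |t| < 2^(N+1) eps] the kernel is at
    most [8 / (4^(N+1) eps)], while the mass of [q] in the larger ball is at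
    most [delta 2^(N+1) eps]; the resulting geometric series stays below
    [16 delta]. *)
Lemma poisson_dyadic (q : R -> R) eps r0 delta :
  measurable_fun setT q -> (forall t, 0 <= q t) -> 0 < eps -> 0 < delta ->
  (forall r, 0 < r <= r0 ->
    (\int[mu]_t (q t * I_ r t)%:E <= (delta * r)%:E)%E) ->
  forall N : nat, 2 ^+ N * eps <= r0 ->
  (\int[mu]_t (poisson eps t * (q t * I_ (2 ^+ N * eps) t))%:E <=
    (delta * (16 - 8 / 2 ^+ N))%:E)%E.
Proof.
move=> mq q0 e0 d0 H; have mI := measurable_ball_indic.
have mP := measurable_poisson e0.
have mqI r : measurable_fun setT (fun t => q t * I_ r t) by exact: measurable_funM.
have qI0 r t : 0 <= q t * I_ r t by rewrite mulr_ge0// ball_indicE.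
have P0 t := poisson_ge0 t e0.
have mPqI r : measurable_fun setT (fun t => poisson eps t * (q t * I_ r t)).
  by apply: measurable_funM; [exact: mP|exact: mqI].
have mcqI a r : measurable_fun setT (fun t => a * (q t * I_ r t)).
  by apply: measurable_funM; [exact: measurable_cst|exact: mqI].
elim=> [|N IH] Nr.
  rewrite expr0 mul1r in Nr *.
  apply: (@le_trans _ _ ((2 / eps)%:E * (delta * eps)%:E)%E).
    apply: le_trans (lee_wpmul2l _ (H eps _)); last 2 first.
      by rewrite lee_fin divr_ge0// ltW.
      by rewrite e0.
    rewrite -integral_scaleE; [|exact: mqI|by rewrite divr_ge0// ltW|exact: qI0].
    apply: integral_leE; [exact: mPqI|exact: mcqI| |].
      by move=> t; rewrite mulr_ge0.
    by move=> t; rewrite ler_wpM2r// poisson_le.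
  rewrite -EFinM lee_fin.
  have -> : 2 / eps * (delta * eps) = delta * 2 by field; rewrite gt_eqF.
  by rewrite ler_pM2l//; lra.
have p2 : 0 < (2:R) ^+ N by rewrite exprn_gt0.
have Ne0 : 0 < 2 ^+ N * eps by rewrite mulr_gt0.
have SN : 2 ^+ N.+1 * eps = 2 * (2 ^+ N * eps) by rewrite exprS mulrA.
pose c := 8 / ((2 ^+ N.+1) ^+ 2 * eps).
have c0 : 0 <= c by rewrite divr_ge0// mulr_ge0 ?sqr_ge0// ltW.
apply: (@le_trans _ _ ((delta * (16 - 8 / 2 ^+ N))%:E + c%:E * (delta * (2 ^+ N.+1 * eps))%:E)%E); last first.
  rewrite -EFinM -EFinD lee_fin /c le_eqVlt; apply/orP; left; apply/eqP.
  by rewrite (exprS 2 N); field; rewrite !gt_eqF.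
have NrN : 2 ^+ N * eps <= r0.
  by rewrite (le_trans _ Nr)// SN ler_peMl ?ltW// ltr1n.
apply: le_trans; last first.
  apply: leeD; first exact: IH.
  apply: lee_wpmul2l (H (2 ^+ N.+1 * eps) _); first by rewrite lee_fin.
  by rewrite SN mulr_gt0//= -SN.
rewrite -integral_scaleE; [|exact: mqI|exact: c0|exact: qI0].
rewrite -integral_addE; last 4 first.
- exact: mPqI.
- exact: mcqI.
- by move=> t; rewrite mulr_ge0.
- by move=> t; rewrite mulr_ge0.
apply: integral_leE.
- exact: mPqI.
- by apply: measurable_funD; [exact: mPqI|exact: mcqI].
- by move=> t; rewrite mulr_ge0.
move=> t; have [tN|tN] := ltP `|t| (2 ^+ N * eps).
  rewrite (_ : I_ (2 ^+ N.+1 * eps) t = I_ (2 ^+ N * eps) t).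
    by rewrite lerDl mulr_ge0.
  have le2 : 2 ^+ N * eps <= 2 * (2 ^+ N * eps) by lra.
  by rewrite !ball_indicE tN SN (lt_le_trans tN).
apply: (@le_trans _ _ (c * (q t * I_ (2 ^+ N.+1 * eps) t))); last first.
  by rewrite lerDr mulr_ge0.
rewrite ler_wpM2r//.
have t0 : t != 0 by rewrite -normr_gt0 (lt_le_trans Ne0).
rewrite (le_trans (poisson_le_tail e0 t0))// /c.
have -> : 8 / ((2 ^+ N.+1) ^+ 2 * eps) = 2 * eps / (2 ^+ N * eps) ^+ 2.
  by rewrite (exprS 2 N); field; rewrite !gt_eqF.
have t2 : 0 < t ^+ 2 by rewrite exprn_even_gt0.
have n2 : 0 < (2 ^+ N * eps) ^+ 2 by rewrite exprn_gt0.
rewrite ler_wpM2l ?mulr_ge0 ?(ltW e0)// lef_pV2 ?posrE//.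
by rewrite -(real_normK (num_real t)) lerXn2r ?nnegrE// ltW.
Qed.

(** Near the origin the dyadic bound applies; away from it the kernel is [eps]
    times a fixed multiple of [poisson 1]. Taking [eps = r0 / 2^N] makes the
    dyadic radii end exactly at [r0]. *)
Lemma poisson_averages_vanish (q : R -> R) :
  measurable_fun setT q -> (forall t, 0 <= q t) ->
  mu.-integrable setT (EFin \o (fun t => poisson 1 t * q t)) ->
  (forall delta, 0 < delta -> exists2 r0, 0 < r0 & forall r, 0 < r <= r0 ->
    (\int[mu]_t (q t * I_ r t)%:E <= (delta * r)%:E)%E) ->
  forall delta eps0, 0 < delta -> 0 < eps0 -> exists2 eps, 0 < eps <= eps0 &
    (\int[mu]_t (poisson eps t * q t)%:E <= delta%:E)%E.
Proof.
move=> mq q0 iq H delta eps0 d0 e00.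
have d32 : 0 < delta / 32 by rewrite divr_gt0.
have [r0 r00 Hr] := H _ d32.
pose M := \int[mu]_t (poisson 1 t * q t).
have M0 : 0 <= M.
  by apply: Rintegral_ge0 => t _; rewrite mulr_ge0// poisson_ge0.
(* [eps * C] bounds the contribution of [|t| >= r0] *)
pose C := (1 + (r0 ^+ 2)^-1) * M.
have C0 : 0 <= C by rewrite mulr_ge0// addr_ge0// invr_ge0 sqr_ge0.
have C1 : 0 < C + 1 by rewrite ltr_wpDl.
pose e1 := Num.min eps0 (delta / 2 / (C + 1)).
have e10 : 0 < e1 by rewrite lt_min e00/= !divr_gt0.
pose N := Num.bound (r0 / e1).
have NE : r0 / 2 ^+ N <= e1.
  rewrite ler_pdivrMr ?exprn_gt0// mulrC -ler_pdivrMr//.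
  have /ltW/le_trans : r0 / e1 < N%:R.
    by apply: archi_boundP; rewrite divr_ge0// ltW.
  by apply; rewrite -natrX ler_nat ltnW// ltn_expl.
set eps := r0 / 2 ^+ N in NE.
have p2 : 0 < (2:R) ^+ N by rewrite exprn_gt0.
have ep0 : 0 < eps by rewrite divr_gt0.
have epsN : 2 ^+ N * eps = r0 by rewrite /eps mulrC divfK// gt_eqF.
move: NE; rewrite le_min => /andP[ee0 eC].
exists eps; first by rewrite ep0.
have := poisson_dyadic mq q0 ep0 d32 Hr (N := N).
rewrite epsN lexx => /(_ isT) near_part.
have mP := measurable_poisson ep0; have mI := measurable_ball_indic.
have mP1 := measurable_poisson (@ltr01 R).
have P0 t := poisson_ge0 t ep0.
have P10 t : 0 <= poisson 1 t by rewrite poisson_ge0.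
have mPq : measurable_fun setT (fun t => poisson eps t * q t).
  by apply: measurable_funM; [exact: mP|exact: mq].
have mPqI : measurable_fun setT (fun t => poisson eps t * (q t * I_ r0 t)).
  apply: measurable_funM; first exact: mP.
  by apply: measurable_funM; [exact: mq|exact: mI].
have mP1q : measurable_fun setT (fun t => poisson 1 t * q t).
  by apply: measurable_funM; [exact: mP1|exact: mq].
have mkP1q a : measurable_fun setT (fun t => a * (poisson 1 t * q t)).
  by apply: measurable_funM; [exact: measurable_cst|exact: mP1q].
have k0 : 0 <= eps * (1 + (r0 ^+ 2)^-1).
  by rewrite mulr_ge0 ?(ltW ep0)// addr_ge0// invr_ge0 sqr_ge0.
apply: (@le_trans _ _ ((delta / 32 * (16 - 8 / 2 ^+ N))%:E + (eps * C)%:E)%E); last first.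
  rewrite -EFinD lee_fin [X in _ <= X]splitr lerD//.
    rewrite -mulrA ler_pM2l//.
    have : 0 <= 8 / (2 : R) ^+ N by rewrite divr_ge0// ltW.
    by move: (8 / 2 ^+ N) => z z0; clear -z0; lra.
  rewrite (le_trans (ler_wpM2r C0 eC))// mulrAC ler_pdivrMr//.
  by rewrite ler_pM2l ?divr_gt0// lerDl.
apply: le_trans (leeD near_part (lexx _)).
rewrite /C mulrA EFinM /M Rintegral_EFin//.
rewrite -integral_scaleE; [|exact: mP1q|exact: k0|by move=> t; rewrite mulr_ge0].
rewrite -integral_addE; last 4 first.
- exact: mPqI.
- exact: mkP1q.
- by move=> t; rewrite mulr_ge0// mulr_ge0.
- by move=> t; rewrite mulr_ge0// mulr_ge0.
apply: integral_leE.
- exact: mPq.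
- by apply: measurable_funD; [exact: mPqI|exact: mkP1q].
- by move=> t; rewrite mulr_ge0.
move=> t; rewrite ball_indicE; case: ltP => tr.
  by rewrite mulr1 lerDl mulr_ge0// mulr_ge0.
by rewrite !mulr0 add0r mulrA ler_wpM2r// poisson_le_far.
Qed.

(** The measure [2 r] of the ball is cleared, so that the condition can be
    summed over dyadic balls without divisions. *)
Definition lebesgue_value (q : R -> R[i]) (c : R[i]) :=
  forall delta, 0 < delta -> exists2 r0, 0 < r0 & forall r, 0 < r <= r0 ->
    (\int[mu]_t (normc (q t - c) * I_ r t)%:E <= (delta * r)%:E)%E.

Lemma continuous_lebesgue_value (q : R -> R[i]) (c : R[i]) : Cmeas q ->
  (forall delta, 0 < delta -> exists2 r0, 0 < r0 & forall t, `|t| <= r0 ->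
    normc (q t - c) <= delta) ->
  lebesgue_value q c.
Proof.
move=> mq cq delta d0; have d2 : 0 < delta / 2 by rewrite divr_gt0.
have [r0 r00 H] := cq _ d2; exists r0 => // r /andP[rp rr].
have mI := measurable_ball_indic r.
apply: (@le_trans _ _ (\int[mu]_t (delta / 2 * I_ r t)%:E)%E).
  apply: integral_leE.
  - apply: measurable_funM => //; apply: Cmeas_normc.
    by apply: CmeasB => //; exact: Cmeas_cst.
  - by apply: measurable_funM.
  - by move=> t; rewrite mulr_ge0 ?normc_ge0// ball_indicE.
  - move=> t; rewrite ball_indicE; case: ltP => tr; rewrite ?mulr0//.
    by rewrite !mulr1 H// (le_trans (ltW tr)).
rewrite integral_scaleE//; last by rewrite ltW.
rewrite integral_indic ?setIT//; last exact: measurable_ball.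
have muB : mu (ball 0 r) = (r *+ 2)%:E := lebesgue_measure_ball 0 (ltW rp).
rewrite [X in (_ * X <= _)%E]muB -EFinM lee_fin -mulr_natr.
by rewrite le_eqVlt; apply/orP; left; apply/eqP; field.
Qed.

(** Lebesgue points are not stable under products in general; a bounded factor
    is harmless. *)
Lemma lebesgue_valueM (q m : R -> R[i]) (c m0 : R[i]) (C : R) :
  Cmeas q -> Cmeas m -> (forall t, normc (m t) <= C) ->
  lebesgue_value q c -> lebesgue_value m m0 ->
  lebesgue_value (fun t => q t * m t) (c * m0).
Proof.
move=> mq mm mC Lq Lm delta d0; have d2 : 0 < delta / 2 by rewrite divr_gt0.
have C0 : 0 <= C by rewrite (le_trans (normc_ge0 (m 0))).
have C1 : 0 < C + 1 by rewrite ltr_wpDl.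
have c1 : 0 < normc c + 1 by rewrite ltr_wpDl// normc_ge0.
have [r1 r10 H1] := Lq _ (divr_gt0 d2 C1).
have [r2 r20 H2] := Lm _ (divr_gt0 d2 c1).
exists (Num.min r1 r2); first by rewrite lt_min r10.
move=> r /andP[rp]; rewrite le_min => /andP[rr1 rr2].
have mI := measurable_ball_indic r.
have I0 t : 0 <= I_ r t by rewrite ball_indicE.
have mqc : measurable_fun setT (fun t : R => normc (q t - c)).
  by apply: Cmeas_normc; apply: CmeasB => //; exact: Cmeas_cst.
have mmc : measurable_fun setT (fun t : R => normc (m t - m0)).
  by apply: Cmeas_normc; apply: CmeasB => //; exact: Cmeas_cst.
have b1 := H1 r; rewrite rp rr1 in b1; have {b1} b1 := b1 isT.
have b2 := H2 r; rewrite rp rr2 in b2; have {b2} b2 := b2 isT.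
have C1' : 0 <= C + 1 by exact: ltW.
have c1' : 0 <= normc c + 1 by exact: ltW.
apply: (@le_trans _ _ ((C + 1)%:E * (delta / 2 / (C + 1) * r)%:E +
   (normc c + 1)%:E * (delta / 2 / (normc c + 1) * r)%:E)%E); last first.
  rewrite -!EFinM -EFinD lee_fin le_eqVlt; apply/orP; left; apply/eqP.
  by field; rewrite !gt_eqF.
apply: le_trans (leeD (lee_wpmul2l _ b1) (lee_wpmul2l _ b2));
  try by rewrite lee_fin.
have f10 t : 0 <= normc (q t - c) * I_ r t by rewrite mulr_ge0// normc_ge0.
have f20 t : 0 <= normc (m t - m0) * I_ r t by rewrite mulr_ge0// normc_ge0.
have mf1 : measurable_fun setT (fun t => normc (q t - c) * I_ r t) by exact: measurable_funM.
have mf2 : measurable_fun setT (fun t => normc (m t - m0) * I_ r t) by exact: measurable_funM.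
rewrite -!integral_scaleE// -integral_addE; last 4 first.
- by apply: measurable_funM.
- by apply: measurable_funM.
- by move=> t; rewrite mulr_ge0.
- by move=> t; rewrite mulr_ge0.
apply: integral_leE.
- apply: measurable_funM => //; apply: Cmeas_normc; apply: CmeasB.
    exact: CmeasM.
  exact: Cmeas_cst.
- by apply: measurable_funD; apply: measurable_funM.
- by move=> t; rewrite mulr_ge0// normc_ge0.
move=> t; rewrite !mulrA -mulrDl ler_wpM2r//.
have -> : q t * m t - c * m0 = (q t - c) * m t + c * (m t - m0) by ring.
rewrite (le_trans (le_normc_add _ _))// !normcMr lerD//.
  by rewrite mulrC ler_wpM2r ?normc_ge0// (le_trans (mC t))// lerDl.
by rewrite ler_wpM2r ?normc_ge0// lerDl.
Qed.

Lemma Cintegrable_poissonM eps (q : R -> R[i]) : 0 < eps -> Cmeas q ->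
  mu.-integrable setT (EFin \o (fun t => poisson 1 t * normc (q t))) ->
  Cintegrable mu (fun t => real_complex R (poisson eps t) * q t).
Proof.
move=> e0 mq iq.
have iq' : mu.-integrable setT
    (EFin \o (fun t => (eps + eps^-1) * (poisson 1 t * normc (q t)))).
  exact: (integrableZl measurableT (eps + eps^-1) iq).
apply: (Cintegrable_dom _ _ iq').
  by apply: CmeasM => //; apply: Cmeas_real; exact: measurable_poisson.
move=> t; rewrite normcMr normc_nneg ?poisson_ge0// mulrA ler_wpM2r ?normc_ge0//.
exact: poisson_le_scale.
Qed.

Lemma integrable_poisson1_bounded (q : R -> R[i]) C : Cmeas q ->
  (forall t, normc (q t) <= C) ->
  mu.-integrable setT (EFin \o (fun t => poisson 1 t * normc (q t))).
Proof.
move=> mq qC.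
have iP := integrableZl measurableT C (integrable_poisson (@ltr01 R)).
apply: (le_integrable measurableT _ _ iP).
  apply/measurable_EFinP; apply: measurable_funM; last exact: Cmeas_normc.
  exact: measurable_poisson.
have C0 : 0 <= C by rewrite (le_trans (normc_ge0 (q 0))).
have P0 t : 0 <= poisson (1 : R) t by exact: poisson_ge0.
move=> t _ /=; rewrite lee_fin (ger0_norm (mulr_ge0 (P0 t) (normc_ge0 (q t)))).
by rewrite (ger0_norm (mulr_ge0 C0 (P0 t))) mulrC ler_wpM2r.
Qed.

(** The Poisson kernel has mass [2 pi] for every [eps], so it suffices to
    average [|q - c|]. *)
Lemma poisson_approximate_identity (q : R -> R[i]) (c : R[i]) : Cmeas q ->
  mu.-integrable setT (EFin \o (fun t => poisson 1 t * normc (q t))) ->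
  lebesgue_value q c ->
  forall delta eps0, 0 < delta -> 0 < eps0 -> exists2 eps, 0 < eps <= eps0 &
    normc (Cintegral mu (fun t => real_complex R (poisson eps t) * q t)
           - real_complex R (2 * pi) * c) <= delta.
Proof.
move=> mq iq Lq delta eps0 d0 e00.
have mc : Cmeas (fun _ : R => c) by exact: Cmeas_cst.
have ic := integrable_poisson1_bounded mc (fun _ => lexx (normc c)).
have mqc : measurable_fun setT (fun t : R => normc (q t - c)).
  by apply: Cmeas_normc; exact: CmeasB.
have iqc : mu.-integrable setT (EFin \o (fun t => poisson 1 t * normc (q t - c))).
  have iD := integrableD measurableT iq ic.
  apply: (le_integrable measurableT _ _ iD).
    by apply/measurable_EFinP; apply: measurable_funM => //; exact: measurable_poisson.
  have P0 t : 0 <= poisson (1 : R) t by exact: poisson_ge0.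
  move=> t _ /=; rewrite lee_fin -mulrDr (ger0_norm (mulr_ge0 (P0 t) (normc_ge0 _))).
  rewrite (le_trans _ (ler_norm _))// ler_wpM2l//.
  by rewrite (le_trans (le_normc_add _ _))// normcN.
have [eps /andP[ep0 ee0] H] := poisson_averages_vanish mqc (fun t => normc_ge0 _) iqc Lq d0 e00.
exists eps; first by rewrite ep0.
have i1 := Cintegrable_poissonM ep0 mq iq.
have i2 := Cintegrable_poissonM ep0 mc ic.
have -> : real_complex R (2 * pi) * c =
    Cintegral mu (fun t => real_complex R (poisson eps t) * c).
  rewrite CintegralZr.
    congr (_ * _); apply: complex_ext => /=.
      by rewrite /Rintegral integral_poisson.
    by rewrite /Rintegral integral0_eq.
  split; last exact: integrable0.
  exact: integrable_poisson.
rewrite (le_trans (le_normc_CintegralB i1 i2))//.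
rewrite -lee_fin Rintegral_EFin; last first.
  exact/Cintegrable_normc/CintegrableB.
apply: le_trans H; rewrite le_eqVlt; apply/orP; left; apply/eqP.
apply: eq_integral => t _; rewrite -mulrBr normcMr normc_nneg ?poisson_ge0//.
Qed.

(** Two expressions of the damped integral of [D], one continuous as the
    damping is removed, the other an approximate identity. *)
Lemma undamped_Cintegral d (T : measurableType d) (nu : {measure set T -> \bar R})
    (w : T -> R) (D : T -> R[i]) (q : R -> R[i]) (c : R[i]) :
  measurable_fun setT w -> Cintegrable nu D -> Cmeas q ->
  mu.-integrable setT (EFin \o (fun t => poisson 1 t * normc (q t))) ->
  lebesgue_value q c ->
  (forall eps, 0 < eps ->
    Cintegral nu (fun p => real_complex R (damp eps (w p)) * D p) =
    Cintegral mu (fun t => real_complex R (poisson eps t) * q t)) ->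
  Cintegral nu D = real_complex R (2 * pi) * c.
Proof.
move=> mw iD mq iq Lq HE.
apply/eqP; rewrite -subr_eq0; apply/eqP/normc_eq0P/eqP.
rewrite eq_le normc_ge0 andbT; apply/ler_addgt0Pl => delta d0; rewrite addr0.
have d2 : 0 < delta / 2 by rewrite divr_gt0.
have mw' : measurable_fun setT (fun p => `|w p|) by exact: measurableT_comp.
have [e1 e10 H1] := exp_damping_cvg mw' (fun p => normr_ge0 _) iD d2.
have [eps ee H2] := poisson_approximate_identity mq iq Lq d2 e10.
have {}H1 := H1 _ ee; have ep0 : 0 < eps by case/andP: ee.
rewrite -/(damp eps _) in H1.
have H1' : normc (Cintegral mu (fun t => real_complex R (poisson eps t) * q t) - Cintegral nu D) <= delta / 2.
  by rewrite -HE.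
rewrite [delta]splitr; rewrite normcBC in H1'.
rewrite (le_trans _ (lerD H1' H2))// (le_trans _ (le_normc_add _ _))//.
by rewrite le_eqVlt; apply/orP; left; apply/eqP; congr normc; ring.
Qed.

End ApproximateIdentity.

(** * Damped Fourier integrals *)

Section Plane.
Context {R : realType}.
Local Notation mu := (@lebesgue_measure R).

(** Named so that it can carry a sigma-finite structure and serve as a factor
    of a further product. *)
Definition plane := (mu \x mu)%E.

Lemma sigma_finite_plane : sigma_finite setT plane.
Proof.
exists (fun n : nat => `[- n%:R, n%:R] `*` `[- n%:R, n%:R] : set (R * R)).
  apply/esym; rewrite -subTset => -[s t] _.
  pose n := Num.bound (Num.max `|s| `|t|).
  have : Num.max `|s| `|t| < n%:R by apply: archi_boundP; rewrite le_max normr_ge0.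
  rewrite gt_max => /andP[/ltW sn /ltW tn]; exists n => //.
  by split; rewrite /= in_itv/= -ler_norml.
move=> n; split; first exact: measurableX.
have E (k : R) : mu (`[- k, k]%classic : set R) \is a fin_num.
  by rewrite lebesgue_measure_itv/=; case: ifP.
rewrite /plane (product_measure1E mu mu)//.
by rewrite lte_mul_pinfty// ?ge0_fin_numE// ?E// ltey_eq ?E.
Qed.

HB.instance Definition _ := Measure.on plane.
HB.instance Definition _ :=
  @Measure_isSigmaFinite.Build _ _ _ plane sigma_finite_plane.

Implicit Types F : measurableTypeR R * measurableTypeR R -> R[i].

Lemma plane_integral12 F : Cintegrable plane F ->
  Cintegral mu (fun x => Cintegral mu (fun y => F (x, y))) = Cintegral plane F.
Proof. exact: Cintegral12. Qed.

Lemma plane_integral21 F : Cintegrable plane F ->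
  Cintegral mu (fun y => Cintegral mu (fun x => F (x, y))) = Cintegral plane F.
Proof. exact: Cintegral21. Qed.

Lemma Cintegrable_plane21 F : Cmeas F ->
  (\int[mu]_y \int[mu]_x (normc (F (x, y)))%:E < +oo)%E -> Cintegrable plane F.
Proof. exact: Cintegrable_prod21. Qed.

End Plane.
Arguments plane : clear implicits.

Section DampedFourier.
Context {R : realType}.
Local Notation mu := (@lebesgue_measure R).
Local Notation "z %:C" := (real_complex R z).
Implicit Types (k l f g h : R -> R[i]) (eps eta y : R).

Lemma Cmeas_expi_comp d (X : measurableType d) (theta : X -> R) :
  measurable_fun setT theta -> Cmeas (fun x => expi (theta x)).
Proof.
move=> mt; rewrite (_ : (fun x => _) = (fun x => expi (theta x * 1))).
  exact: (Cmeas_comp mt (measurable_expi 1)).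
by apply/funext => x; rewrite mulr1.
Qed.

Lemma Cintegrable_phase d (X : measurableType d) (nu : {measure set X -> \bar R})
    (a : X -> R[i]) (theta : X -> R) :
  Cintegrable nu a -> measurable_fun setT theta ->
  Cintegrable nu (fun x => a x * expi (theta x)).
Proof.
move=> ia mt; apply: (Cintegrable_dom _ _ (Cintegrable_normc ia)).
  by apply: CmeasM; [exact: Cintegrable_meas ia|exact: Cmeas_expi_comp].
by move=> x; rewrite normcMr normc_expi mulr1.
Qed.

(** The damping makes the double integral in [eta] and [x] absolutely
    convergent, which it is not without it. *)
Lemma damped_phase d (X : measurableType d)
    (nu : {sigma_finite_measure set X -> \bar R}) (a : X -> R[i])
    (theta : X -> R) eps :
  Cintegrable nu a -> measurable_fun setT theta -> 0 < eps ->
  Cintegral mu (fun eta => (damp eps eta)%:C *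
    Cintegral nu (fun x => a x * expi (eta * theta x))) =
  Cintegral nu (fun x => a x * (poisson eps (theta x))%:C).
Proof.
move=> ia mt e0.
pose F (p : measurableTypeR R * X) :=
  (damp eps p.1)%:C * (a p.2 * expi (p.1 * theta p.2)).
have iF : Cintegrable (mu \x nu)%E F.
  have iG := integrable_tensor (integrable_damp e0) (Cintegrable_normc ia).
  apply: (Cintegrable_dom _ _ iG).
    apply: CmeasM.
      apply: Cmeas_real; apply: (measurableT_comp (measurable_damp eps)).
      exact: measurable_fst.
    apply: CmeasM; first exact: (Cmeas_comp measurable_snd (Cintegrable_meas ia)).
    apply: Cmeas_expi_comp; apply: measurable_funM; first exact: measurable_fst.
    exact: (measurableT_comp mt measurable_snd).
  move=> p; rewrite /F !normcMr normc_expi mulr1 normc_nneg// damp_ge0//.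
have mte eta : measurable_fun setT (fun x => eta * theta x) by exact: measurable_funM.
transitivity (Cintegral mu (fun eta => Cintegral nu (fun x => F (eta, x)))).
  congr Cintegral; apply/funext => eta; rewrite /F/= CintegralZl//.
  exact: Cintegrable_phase.
rewrite Cintegral_swap//; congr Cintegral; apply/funext => x; rewrite /F/=.
under eq_fun do rewrite mulrCA.
by rewrite CintegralZl ?Cintegral_damp_expi//; exact: Cintegrable_damp_expi.
Qed.

Definition fourier k eta : R[i] :=
  Cintegral mu (fun t => k t * conjc (expi (eta * t))).

Lemma measurable_scale eta : measurable_fun setT (fun t : R => eta * t).
Proof. by apply: measurable_funM. Qed.

Lemma Cintegrable_fourier k eta : Cintegrable mu k ->
  Cintegrable mu (fun t => k t * conjc (expi (eta * t))).
Proof.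
move=> ik; under eq_fun do rewrite conjc_expi -mulNr.
by apply: Cintegrable_phase => //; exact: measurable_scale.
Qed.

Lemma Cintegrable_shift k y : Cintegrable mu k ->
  Cintegrable mu (fun t => k (t + y)).
Proof.
move=> ik; have mk := Cintegrable_meas ik.
apply: Cintegrable_lty; first exact: (Cmeas_comp (measurable_shift y) mk).
rewrite (ge0_integral_shift y (f := fun t => (normc (k t))%:E)).
- exact: (integrable_nonneg_lty (Cintegrable_normc ik)).
- by apply/measurable_EFinP; exact: Cmeas_normc.
- by move=> t; rewrite lee_fin normc_ge0.
Qed.

Lemma fourier_shift k eta y : Cintegrable mu k ->
  Cintegral mu (fun tau => k (tau + y) * expi (eta * - tau)) =
  fourier k eta * expi (eta * y).
Proof.
move=> ik; have iF := Cintegrable_fourier eta ik.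
rewrite /fourier -CintegralZr//.
rewrite -[RHS](Cintegral_shift y); last first.
  by apply: (Cintegrable_meas (mu := mu)); exact: CintegrableZr.
congr Cintegral; apply/funext => t.
by rewrite conjc_expi -mulrA -expiD; congr (_ * expi _); ring.
Qed.

Lemma damped_fourier_inversion k eps y : Cintegrable mu k -> 0 < eps ->
  Cintegral mu (fun eta => (damp eps eta)%:C * (fourier k eta * expi (eta * y))) =
  Cintegral mu (fun tau => k (tau + y) * (poisson eps tau)%:C).
Proof.
move=> ik e0.
have mN : measurable_fun setT (fun t : R => - t) by exact: oppr_measurable.
have := damped_phase (Cintegrable_shift y ik) mN e0.
rewrite (_ : (fun x => k (x + y) * (poisson eps (- x))%:C) = fun x : R =>
  k (x + y) * (poisson eps x)%:C); last by apply/funext => t; rewrite poissonN.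
move=> <-; congr Cintegral; apply/funext => eta.
by rewrite fourier_shift.
Qed.

Lemma Cintegrable_correlation k l : Cintegrable mu k -> Cintegrable mu l ->
  Cintegrable (plane R) (fun p => k (p.1 + p.2) * conjc (l p.2)).
Proof.
move=> ik il; have mk := Cintegrable_meas ik; have ml := Cintegrable_meas il.
apply: Cintegrable_plane21.
  apply: CmeasM; last exact: (Cmeas_comp measurable_snd (Cmeas_conj ml)).
  by apply: (Cmeas_comp _ mk); apply: measurable_funD.
have ioo := integrable_nonneg_lty (integrableZl measurableT
  (\int[mu]_t normc (k t)) (Cintegrable_normc il)).
have mnk := Cmeas_normc mk.
apply: le_lt_trans ioo; rewrite le_eqVlt; apply/orP; left; apply/eqP.
apply: eq_integral => s _ /=.
under eq_integral do rewrite normcMr normc_conj mulrC.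
rewrite integral_scaleE ?normc_ge0//.
- rewrite (ge0_integral_shift s (f := fun t => (normc (k t))%:E)).
  + by rewrite -Rintegral_EFin ?EFinM 1?muleC//; exact: Cintegrable_normc.
  + exact/measurable_EFinP.
  + by move=> t; rewrite lee_fin normc_ge0.
- exact: (measurableT_comp mnk (measurable_shift s)).
- by move=> t; rewrite normc_ge0.
Qed.

(** [fourier k] times the conjugate of [fourier l] is the transform of the
    correlation of [k] and [l]. *)
Lemma damped_fourier_pairing k l eps : Cintegrable mu k -> Cintegrable mu l ->
  0 < eps ->
  Cintegral mu (fun eta => (damp eps eta)%:C * (fourier k eta * conjc (fourier l eta))) =
  Cintegral (plane R)
    (fun p => k (p.1 + p.2) * conjc (l p.2) * (poisson eps p.1)%:C).
Proof.
move=> ik il e0.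
pose a (p : measurableTypeR R * measurableTypeR R) := k (p.1 + p.2) * conjc (l p.2).
have mN : measurable_fun setT (fun p : measurableTypeR R * measurableTypeR R => - p.1).
  by apply: measurable_funN; exact: measurable_fst.
have ia : Cintegrable (plane R) a := Cintegrable_correlation ik il.
have := damped_phase ia mN e0.
rewrite (_ : (fun x => a x * (poisson eps (- x.1))%:C) = fun p =>
  k (p.1 + p.2) * conjc (l p.2) * (poisson eps p.1)%:C); last first.
  by apply/funext => p; rewrite poissonN.
move=> <-; congr Cintegral; apply/funext => eta; congr (_ * _).
rewrite -plane_integral21; last first.
  by apply: Cintegrable_phase => //; apply: measurable_funM.
rewrite /a/=.
have il' := Cintegrable_fourier eta il.
symmetry; transitivity (fourier k eta * Cintegral mu (fun t => conjc (l t * conjc (expi (eta * t)))));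
    last by congr (_ * _); exact: (Cintegral_conj il').
rewrite -CintegralZl; last exact: Cintegrable_conj.
congr Cintegral; apply/funext => s.
rewrite conjcM conjcK mulrCA mulrC -fourier_shift// mulrC -CintegralZl.
  by congr Cintegral; apply/funext => t; ring.
apply: Cintegrable_phase; first exact: Cintegrable_shift.
by apply: measurable_funM => //; exact: oppr_measurable.
Qed.

End DampedFourier.

(** * Energy of the Gabor coefficients *)

Section GaborAnalysis.
Context {R : realType}.
Local Notation mu := (@lebesgue_measure R).
Local Notation "z %:C" := (real_complex R z).
Local Notation N2 f := (\int[mu]_t normc (f t) ^+ 2).
Local Notation plane := (plane R).
Local Notation point := (measurableTypeR R * measurableTypeR R)%type.
Implicit Types (f g h k : R -> R[i]) (eps eta u tau s y : R).

Lemma L2_gabor_atom g (p : R * R) : L2 g -> L2 (gabor_atom g p).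
Proof.
move=> lg; apply: (@L2_mul_bounded _ _ _ 1).
- by apply: Cmeas_expi_comp; exact: measurable_scale.
- by move=> t; rewrite normc_expi.
- exact: (L2_translate (- p.1) lg).
Qed.

Lemma Cintegrable_window f g u : L2 f -> L2 g ->
  Cintegrable mu (fun t => f t * conjc (g (t - u))).
Proof.
by move=> lf lg; apply: L2_Cintegrable_conj => //; exact: (L2_translate (- u) lg).
Qed.

Lemma inner_gabor_atom f g u eta :
  inner f (gabor_atom g (u, eta)) = fourier (fun t => f t * conjc (g (t - u))) eta.
Proof.
congr Cintegral; apply/funext => t.
by rewrite /gabor_atom /modulation /translation/= conjcM mulrA mulrAC.
Qed.

Lemma Cmeas_gabor f g : Cmeas f -> Cmeas g ->
  Cmeas (fun p : point => inner f (gabor_atom g p)).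
Proof.
move=> mf mg; apply: (Cmeas_param mu
  (F := fun z : point * measurableTypeR R => f z.2 * conjc (gabor_atom g z.1 z.2))).
have m1 : measurable_fun setT (fun z : point * measurableTypeR R => z.1.1).
  exact: (measurableT_comp measurable_fst measurable_fst).
have m2 : measurable_fun setT (fun z : point * measurableTypeR R => z.1.2).
  exact: (measurableT_comp measurable_snd measurable_fst).
apply: CmeasM; first exact: (Cmeas_comp measurable_snd mf).
apply: Cmeas_conj; apply: CmeasM.
  apply: Cmeas_expi_comp; apply: measurable_funM => //; exact: measurable_snd.
by apply: (Cmeas_comp _ mg); apply: measurable_funB => //; exact: measurable_snd.
Qed.

Lemma Cmeas_fourier k : Cmeas k -> Cmeas (fourier k).
Proof.
move=> mk; apply: (Cmeas_param mu
  (F := fun z : point => k z.2 * conjc (expi (z.1 * z.2)))).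
apply: CmeasM; first exact: (Cmeas_comp measurable_snd mk).
apply: Cmeas_conj; apply: Cmeas_expi_comp.
by apply: measurable_funM; [exact: measurable_fst|exact: measurable_snd].
Qed.

Lemma fourier_bounded k eta : Cintegrable mu k ->
  normc (fourier k eta) <= \int[mu]_t normc (k t).
Proof.
move=> ik; rewrite (le_trans (le_normc_Cintegral (Cintegrable_fourier eta ik)))//.
rewrite le_eqVlt; apply/orP; left; apply/eqP; congr Rintegral; apply/funext => t.
by rewrite normcMr normc_conj normc_expi mulr1.
Qed.

(** The window enters the [u]-integral only through its autocorrelation, which
    does not depend on the base point [s]. *)
Lemma window_correlation g s tau : L2 g ->
  Cintegral mu (fun u => g (s - u) * conjc (g (s + tau - u))) =
  conjc (correlation g g tau).
Proof.
move=> lg; have lgt := L2_translate tau lg.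
rewrite -[RHS]Cintegral_conj; last exact: L2_Cintegrable_conj.
rewrite -[RHS](Cintegral_reflect s).
  congr Cintegral; apply/funext => u.
  by rewrite conjcM conjcK mulrC; congr (conjc (g _) * _); ring.
apply: Cmeas_conj; apply: CmeasM; first exact: L2_Cmeas.
by apply: Cmeas_conj; exact: L2_Cmeas.
Qed.

Lemma window_correlation_bound g s tau : L2 g ->
  (\int[mu]_u (normc (g (s - u)) * normc (g (s + tau - u)))%:E <= (N2 g)%:E)%E.
Proof.
move=> lg; have mg := L2_Cmeas lg.
apply: le_trans (integral_young (L2_reflect s lg) (L2_reflect (s + tau) lg) ltr01) _.
rewrite lee_fin invr1 !mul1r !N2_reflect//.
by move: (N2 g) => z; lra.
Qed.

Lemma conj_correlation_bounded g tau : L2 g -> normc (conjc (correlation g g tau)) <= N2 g.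
Proof.
move=> lg; rewrite normc_conj (le_trans (correlation_bounded tau lg lg))//.
by move: (N2 g) => z; lra.
Qed.

(** Integrating out [s] first leaves a bounded correlation, integrated against
    the Poisson kernel. *)
Lemma correlation_weight_bound f h eps : L2 f -> L2 h -> 0 < eps ->
  (\int[plane]_p (poisson eps p.1 * (normc (f (p.2 + p.1)) * normc (h p.2)))%:E
   <= (2 * pi * ((N2 f + N2 h) / 2))%:E)%E.
Proof.
move=> lf lh e0.
have mf := L2_Cmeas lf; have mh := L2_Cmeas lh.
have mB : measurable_fun setT (fun p : point =>
    poisson eps p.1 * (normc (f (p.2 + p.1)) * normc (h p.2))).
  apply: measurable_funM; first exact: (measurableT_comp (measurable_poisson e0) measurable_fst).
  apply: measurable_funM; apply: Cmeas_normc.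
    apply: (Cmeas_comp _ mf); apply: measurable_funD; first exact: measurable_snd.
    exact: measurable_fst.
  exact: (Cmeas_comp measurable_snd mh).
have P0 t := poisson_ge0 t e0.
have B0 p : 0 <= poisson eps p.1 * (normc (f (p.2 + p.1)) * normc (h p.2)).
  by rewrite mulr_ge0// mulr_ge0 ?normc_ge0.
have -> : (\int[plane]_p (poisson eps p.1 * (normc (f (p.2 + p.1)) * normc (h p.2)))%:E =
  \int[mu]_tau \int[mu]_s (poisson eps tau * (normc (f (s + tau)%R) * normc (h s)))%:E)%E.
  apply: (fubini_tonelli1 (m1 := mu) (m2 := mu) (EFin \o fun p : point => poisson eps p.1 *
     (normc (f (p.2 + p.1)) * normc (h p.2)))).
    exact/measurable_EFinP.
  by move=> p; rewrite lee_fin.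
have c0 : 0 <= (N2 f + N2 h) / 2 by rewrite divr_ge0 ?addr_ge0 ?N2_ge0.
rewrite mulrC EFinM -(integral_poisson e0) -integral_scaleE//; last exact: measurable_poisson.
apply: ge0_le_integral => //.
- by move=> tau _; apply: integral_ge0 => s _; rewrite lee_fin mulr_ge0// mulr_ge0 ?normc_ge0.
- apply: (measurable_fun_fubini_tonelli_F (m2 := mu) (EFin \o fun p : point =>
    poisson eps p.1 * (normc (f (p.2 + p.1)) * normc (h p.2)))).
    exact/measurable_EFinP.
  by move=> p; rewrite lee_fin.
- apply/measurable_EFinP; apply: measurable_funM => //; exact: measurable_poisson.
move=> tau _; rewrite integral_scaleE//.
- rewrite [X in (_ <= X%:E)%E]mulrC (EFinM (poisson eps tau)); apply: lee_wpmul2l.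
    by rewrite lee_fin.
  apply: le_trans (integral_young (L2_translate tau lf) lh ltr01) _.
  by rewrite invr1 !mul1r N2_translate.
- apply: measurable_funM; apply: Cmeas_normc => //.
  exact: (Cmeas_comp (measurable_shift tau) mf).
- by move=> s; rewrite mulr_ge0 ?normc_ge0.
Qed.

Lemma measurable_triple :
  [/\ measurable_fun setT (fun z : measurableTypeR R * point => z.2.1),
      measurable_fun setT (fun z : measurableTypeR R * point => z.2.2) &
      measurable_fun setT (fun z : measurableTypeR R * point => z.1)].
Proof.
split; last exact: measurable_fst.
  exact: (measurableT_comp measurable_fst measurable_snd).
exact: (measurableT_comp measurable_snd measurable_snd).
Qed.

(** What remains of the damped product of the coefficients of [f] and [h] at
    translation [u = z.1] once the frequency has been integrated out; [z.2] holds
    the lag and the base point of the correlation. *)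
Definition gabor_triple f g h eps (z : measurableTypeR R * point) : R[i] :=
  f (z.2.1 + z.2.2) * conjc (g (z.2.1 + z.2.2 - z.1)) *
  conjc (h z.2.2 * conjc (g (z.2.2 - z.1))) * (poisson eps z.2.1)%:C.

Lemma Cmeas_gabor_triple f g h eps : L2 f -> L2 g -> L2 h -> 0 < eps ->
  Cmeas (gabor_triple f g h eps).
Proof.
move=> lf lg lh e0; have [m1 m2 m3] := measurable_triple.
have mf := L2_Cmeas lf; have mg := L2_Cmeas lg; have mh := L2_Cmeas lh.
have m12 : measurable_fun setT (fun z : measurableTypeR R * point => z.2.1 + z.2.2).
  exact: measurable_funD.
apply: CmeasM; last first.
  by apply: Cmeas_real; exact: (measurableT_comp (measurable_poisson e0) m1).
apply: CmeasM.
  apply: CmeasM; first exact: (Cmeas_comp m12 mf).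
  by apply: Cmeas_conj; apply: (Cmeas_comp _ mg); exact: measurable_funB.
apply: Cmeas_conj; apply: CmeasM; first exact: (Cmeas_comp m2 mh).
by apply: Cmeas_conj; apply: (Cmeas_comp _ mg); exact: measurable_funB.
Qed.

(** The bound does not depend on the damping, which is what makes the
    undamped energy finite. *)
Lemma gabor_triple_bound f g h eps : L2 f -> L2 g -> L2 h -> 0 < eps ->
  (\int[plane]_p \int[mu]_u (normc (gabor_triple f g h eps (u, p)))%:E <=
   (N2 g * (2 * pi * ((N2 f + N2 h) / 2)))%:E)%E.
Proof.
move=> lf lg lh e0.
have mf := L2_Cmeas lf; have mg := L2_Cmeas lg; have mh := L2_Cmeas lh.
have P0 t := poisson_ge0 t e0.
have mB : measurable_fun setT (fun p : point =>
    poisson eps p.1 * (normc (f (p.2 + p.1)) * normc (h p.2))).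
  apply: measurable_funM; first exact: (measurableT_comp (measurable_poisson e0) measurable_fst).
  apply: measurable_funM; apply: Cmeas_normc.
    apply: (Cmeas_comp _ mf); apply: measurable_funD; first exact: measurable_snd.
    exact: measurable_fst.
  exact: (Cmeas_comp measurable_snd mh).
rewrite EFinM.
apply: le_trans (lee_wpmul2l _ (correlation_weight_bound lf lh e0)); last first.
  by rewrite lee_fin N2_ge0.
rewrite -integral_scaleE//; last 2 first.
- exact: N2_ge0.
- by move=> p; rewrite mulr_ge0// mulr_ge0 ?normc_ge0.
apply: ge0_le_integral => //.
- by move=> p _; apply: integral_ge0 => u _; rewrite lee_fin normc_ge0.
- apply: (measurable_fun_fubini_tonelli_G (m1 := mu)
    (EFin \o fun z => normc (gabor_triple f g h eps z))).
    by apply/measurable_EFinP; apply: Cmeas_normc; exact: Cmeas_gabor_triple.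
  by move=> p; rewrite lee_fin normc_ge0.
- by apply/measurable_EFinP; exact: measurable_funM.
move=> [tau s] _ /=.
under eq_integral => u _.
  rewrite /gabor_triple/= !normcMr !normc_conj normcMr normc_conj normc_nneg//.
  rewrite (_ : _ * _ * _ * _ = poisson eps tau * (normc (f (s + tau)) * normc (h s)) *
    (normc (g (s - u)) * normc (g (s + tau - u)))); last by rewrite (addrC s tau); ring.
  over.
rewrite integral_scaleE.
- rewrite [X in (_ <= X%:E)%E]mulrC (EFinM (poisson eps tau * _)); apply: lee_wpmul2l.
    by rewrite lee_fin mulr_ge0// mulr_ge0 ?normc_ge0.
  exact: window_correlation_bound.
- apply: measurable_funM; apply: Cmeas_normc.
    exact: (Cmeas_comp (measurable_reflect s) mg).
  exact: (Cmeas_comp (measurable_reflect (s + tau)) mg).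
- by rewrite mulr_ge0// mulr_ge0 ?normc_ge0.
- by move=> u; rewrite mulr_ge0 ?normc_ge0.
Qed.

Lemma Cintegrable_gabor_triple f g h eps : L2 f -> L2 g -> L2 h -> 0 < eps ->
  Cintegrable (mu \x plane)%E (gabor_triple f g h eps).
Proof.
move=> lf lg lh e0; apply: Cintegrable_prod21; first exact: Cmeas_gabor_triple.
by apply: le_lt_trans (gabor_triple_bound lf lg lh e0) _; rewrite ltry.
Qed.

Lemma Cintegrable_damped_pairing k l eps : Cintegrable mu k -> Cintegrable mu l ->
  0 < eps ->
  Cintegrable mu (fun eta => (damp eps eta)%:C * (fourier k eta * conjc (fourier l eta))).
Proof.
move=> ik il e0.
pose C := (\int[mu]_t normc (k t)) * \int[mu]_t normc (l t).
have iC : mu.-integrable setT (EFin \o (fun eta => C * damp eps eta)).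
  exact: (integrableZl measurableT C (integrable_damp e0)).
apply: (Cintegrable_dom _ _ iC).
  apply: CmeasM; first by apply: Cmeas_real; exact: measurable_damp.
  apply: CmeasM; first exact/Cmeas_fourier/(Cintegrable_meas ik).
  exact/Cmeas_conj/Cmeas_fourier/(Cintegrable_meas il).
move=> eta; rewrite !normcMr normc_conj normc_nneg ?damp_ge0// mulrC.
rewrite ler_wpM2r ?damp_ge0// /C; apply: ler_pM; rewrite ?normc_ge0//;
  exact: fourier_bounded.
Qed.

(** At a fixed translation the damped energy is a Poisson integral of a
    correlation, which is then bounded by absolute values. *)
Lemma damped_energy_fiber k eps : Cintegrable mu k -> 0 < eps ->
  (\int[mu]_eta (damp eps eta * normc (fourier k eta) ^+ 2)%:E <=
   \int[plane]_p (normc (k (p.1 + p.2) * conjc (k p.2) * (poisson eps p.1)%:C))%:E)%E.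
Proof.
move=> ik e0.
have iD := Cintegrable_damped_pairing ik ik e0.
have DE eta : (damp eps eta)%:C * (fourier k eta * conjc (fourier k eta)) =
    (damp eps eta * normc (fourier k eta) ^+ 2)%:C.
  by rewrite mulc_conj -rmorphM.
have iR : mu.-integrable setT (EFin \o (fun eta => damp eps eta * normc (fourier k eta) ^+ 2)).
  by case: iD => + _; under eq_fun do rewrite DE.
have iP : Cintegrable plane (fun p => k (p.1 + p.2) * conjc (k p.2) * (poisson eps p.1)%:C).
  have ia := Cintegrable_correlation ik ik.
  have iZ : plane.-integrable setT
      (EFin \o (fun p : point => 2 / eps * normc (k (p.1 + p.2) * conjc (k p.2)))).
    exact: (integrableZl measurableT (2 / eps) (Cintegrable_normc ia)).
  apply: (Cintegrable_dom _ _ iZ).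
    apply: CmeasM; first exact: (Cintegrable_meas ia).
    by apply: Cmeas_real; exact: (measurableT_comp (measurable_poisson e0) measurable_fst).
  move=> p; rewrite normcMr mulrC normc_nneg ?poisson_ge0//.
  by rewrite ler_wpM2r ?normc_ge0// poisson_le.
rewrite -Rintegral_EFin// -Rintegral_EFin; last exact: Cintegrable_normc.
rewrite lee_fin.
apply: le_trans (le_normc_Cintegral iP).
rewrite -(damped_fourier_pairing ik ik e0).
apply: le_trans (ler_Re_normc _); rewrite (le_trans _ (ler_norm _))//.
rewrite le_eqVlt; apply/orP; left; apply/eqP.
transitivity (complex.Re (Cintegral mu (fun eta =>
   (damp eps eta * normc (fourier k eta) ^+ 2)%:C))); first by [].
by congr (complex.Re (Cintegral _ _)); apply/funext => eta; rewrite DE.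
Qed.

Lemma damped_energy_bound f g eps : L2 f -> L2 g -> 0 < eps ->
  (\int[plane]_p (damp eps p.2 * normc (inner f (gabor_atom g p)) ^+ 2)%:E <=
   (N2 g * (2 * pi * ((N2 f + N2 f) / 2)))%:E)%E.
Proof.
move=> lf lg e0.
apply: le_trans (gabor_triple_bound lf lg lf e0).
have mV := Cmeas_gabor (L2_Cmeas lf) (L2_Cmeas lg).
have mD : measurable_fun setT (fun p : point =>
    damp eps p.2 * normc (inner f (gabor_atom g p)) ^+ 2).
  apply: measurable_funM; first exact: (measurableT_comp (measurable_damp eps) measurable_snd).
  by apply: measurable_funX; exact: Cmeas_normc.
have D0 p : 0 <= damp eps p.2 * normc (inner f (gabor_atom g p)) ^+ 2.
  by rewrite mulr_ge0 ?damp_ge0// sqr_ge0.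
have -> : (\int[plane]_p (damp eps p.2 * normc (inner f (gabor_atom g p)) ^+ 2)%:E =
  \int[mu]_u \int[mu]_eta (damp eps eta * normc (inner f (gabor_atom g (u, eta))) ^+ 2)%:E)%E.
  apply: (fubini_tonelli1 (m1 := mu) (m2 := mu) (EFin \o fun p : point =>
     damp eps p.2 * normc (inner f (gabor_atom g p)) ^+ 2)).
    exact/measurable_EFinP.
  by move=> p; rewrite lee_fin.
have mT : measurable_fun setT (EFin \o fun z => normc (gabor_triple f g f eps z)).
  by apply/measurable_EFinP; apply: Cmeas_normc; exact: Cmeas_gabor_triple.
have T0 z : (0 <= (EFin \o fun z => normc (gabor_triple f g f eps z)) z)%E.
  by rewrite lee_fin normc_ge0.
have <- : (\int[mu]_u \int[plane]_p (normc (gabor_triple f g f eps (u, p)))%:E =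
  \int[plane]_p \int[mu]_u (normc (gabor_triple f g f eps (u, p)))%:E)%E.
  exact: (fubini_tonelli (m1 := mu) (m2 := plane) _ mT T0).
apply: ge0_le_integral => //.
- by move=> u _; apply: integral_ge0 => eta _; rewrite lee_fin (D0 (u, eta)).
- apply: (measurable_fun_fubini_tonelli_F (m2 := mu) (EFin \o fun p : point =>
     damp eps p.2 * normc (inner f (gabor_atom g p)) ^+ 2)).
    exact/measurable_EFinP.
  by move=> p; rewrite lee_fin.
- exact: (measurable_fun_fubini_tonelli_F (m2 := plane) _ mT T0).
move=> u _; under eq_integral do rewrite inner_gabor_atom.
exact: (damped_energy_fiber (Cintegrable_window u lf lg) e0).
Qed.

End GaborAnalysis.

(** * Orthogonality and inversion of the Gabor coefficients *)

Section Undamping.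
Context d {T : measurableType d} {R : realType} (nu : {measure set T -> \bar R}).

(** Monotone convergence as the damping is removed. *)
Lemma undamped_integral_le (w phi : T -> R) (M : R) :
  measurable_fun setT w -> measurable_fun setT phi -> (forall t, 0 <= phi t) ->
  (forall eps, 0 < eps ->
     (\int[nu]_t (damp eps (w t) * phi t)%:E <= M%:E)%E) ->
  (\int[nu]_t (phi t)%:E <= M%:E)%E.
Proof.
move=> mw mphi phi0 H.
pose F (n : nat) t := (damp n.+1%:R^-1 (w t) * phi t)%:E.
have mF n : measurable_fun setT (F n).
  apply/measurable_EFinP; apply: measurable_funM => //.
  exact: (measurableT_comp (measurable_damp _) mw).
have F0 n t : setT t -> (0 <= F n t)%E.
  by move=> _; rewrite lee_fin mulr_ge0// damp_ge0.
have ndF t : setT t -> nondecreasing_seq (F ^~ t).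
  move=> _ m n mn; rewrite lee_fin ler_wpM2r// ler_expR lerN2 ler_wpM2r//.
  by rewrite lef_pV2 ?posrE// ler_nat ltnS.
have Fphi t : F ^~ t @ \oo --> (phi t)%:E.
  apply: cvg_EFin; first by near=> n.
  rewrite -[X in _ --> X](mul1r (phi t)).
  apply: cvgM; last exact: cvg_cst.
  rewrite [X in _ --> X](_ : 1 = expR (- 0)); last by rewrite oppr0 expR0.
  apply: continuous_cvg; first exact: continuous_expR.
  apply: cvgN; rewrite -[X in _ --> X](mul0r `|w t|).
  by apply: cvgM; [exact: cvg_harmonic|exact: cvg_cst].
have cvI := cvg_monotone_convergence measurableT mF F0 ndF.
rewrite (_ : (fun t => (phi t)%:E) = fun t => limn (F ^~ t)); last first.
  by apply/funext => t; apply/esym/cvg_lim => //; exact: Fphi.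
have {}cvI := cvI nu; rewrite -(cvg_lim _ cvI)//; apply: lime_le.
  by apply/cvg_ex; eexists; exact: cvI.
by apply: nearW => n; apply: H; rewrite invr_gt0.
Unshelve. all: by end_near. Qed.

End Undamping.

Section GaborIdentities.
Context {R : realType}.
Local Notation mu := (@lebesgue_measure R).
Local Notation "z %:C" := (real_complex R z).
Local Notation N2 f := (\int[mu]_t normc (f t) ^+ 2).
Local Notation plane := (plane R).
Local Notation point := (measurableTypeR R * measurableTypeR R)%type.
Implicit Types (f g h k : R -> R[i]) (eps eta u tau s y : R).

(** The damped energies are bounded uniformly in the damping. *)
Lemma gabor_energy f g : L2 f -> L2 g ->
  plane.-integrable setT (EFin \o (fun p => normc (inner f (gabor_atom g p)) ^+ 2)).
Proof.
move=> lf lg.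
have mV := Cmeas_gabor (L2_Cmeas lf) (L2_Cmeas lg).
have mV2 : measurable_fun setT (fun p : point => normc (inner f (gabor_atom g p)) ^+ 2).
  by apply: measurable_funX; exact: Cmeas_normc.
apply: integrable_nonneg => //; first by move=> p; rewrite sqr_ge0.
apply: (@le_lt_trans _ _ (N2 g * (2 * pi * ((N2 f + N2 f) / 2)))%:E); last by rewrite ltry.
apply: (undamped_integral_le (w := fun p : point => p.2)) => //.
- exact: measurable_snd.
- by move=> p; rewrite sqr_ge0.
- by move=> eps e0; exact: damped_energy_bound.
Qed.

Lemma Cintegrable_gabor_product f g h : L2 f -> L2 g -> L2 h ->
  Cintegrable plane (fun p =>
    inner f (gabor_atom g p) * conjc (inner h (gabor_atom g p))).
Proof.
move=> lf lg lh; have mg := L2_Cmeas lg.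
have iS := integrableD measurableT (gabor_energy lf lg) (gabor_energy lh lg).
have {}iS : plane.-integrable setT (EFin \o (fun p : point =>
   normc (inner f (gabor_atom g p)) ^+ 2 + normc (inner h (gabor_atom g p)) ^+ 2)).
  exact: iS.
apply: (Cintegrable_dom _ _ iS).
  apply: CmeasM; first exact: (Cmeas_gabor (L2_Cmeas lf) mg).
  exact/Cmeas_conj/(Cmeas_gabor (L2_Cmeas lh) mg).
move=> p; rewrite normcMr normc_conj (le_trans (young_product _ _ ltr01))//.
rewrite invr1 !mul1r.
have := sqr_ge0 (normc (inner f (gabor_atom g p))).
have := sqr_ge0 (normc (inner h (gabor_atom g p))).
by move: (_ ^+ 2) => a a0; move: (_ ^+ 2) => b b0; lra.
Qed.

Lemma Cintegrable_damped (F : R * R -> R[i]) eps : 0 < eps ->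
  Cintegrable plane F -> Cintegrable plane (fun p => (damp eps p.2)%:C * F p).
Proof.
move=> e0 iF; apply: (Cintegrable_dom _ _ (Cintegrable_normc iF)).
  apply: CmeasM; last exact: (Cintegrable_meas iF).
  by apply: Cmeas_real; exact: (measurableT_comp (measurable_damp eps) measurable_snd).
move=> p; rewrite normcMr normc_nneg ?damp_ge0// ler_piMl ?normc_ge0//.
by rewrite damp_le1// ltW.
Qed.

Lemma Cintegrable_weighted_correlation f g h eps : L2 f -> L2 g -> L2 h ->
  0 < eps ->
  Cintegrable plane (fun p : point => (poisson eps p.1)%:C *
    (f (p.2 + p.1) * conjc (h p.2) * conjc (correlation g g p.1))).
Proof.
move=> lf lg lh e0.
have mf := L2_Cmeas lf; have mh := L2_Cmeas lh.
have m1 : measurable_fun setT (fun p : point => p.1) by exact: measurable_fst.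
have m2 : measurable_fun setT (fun p : point => p.2) by exact: measurable_snd.
have mP : measurable_fun setT (fun p : point => poisson eps p.1).
  exact: (measurableT_comp (measurable_poisson e0) m1).
have mfs : Cmeas (fun p : point => f (p.2 + p.1)).
  by apply: (Cmeas_comp _ mf); exact: measurable_funD.
have mhs : Cmeas (fun p : point => h p.2) by exact: (Cmeas_comp m2 mh).
have P0 t := poisson_ge0 t e0.
have iB : plane.-integrable setT (EFin \o (fun p : point =>
    poisson eps p.1 * (normc (f (p.2 + p.1)) * normc (h p.2)))).
  apply: integrable_nonneg.
  - apply: measurable_funM; first exact: mP.
    by apply: measurable_funM; exact: Cmeas_normc.
  - by move=> p; rewrite mulr_ge0// mulr_ge0 ?normc_ge0.
  - by apply: le_lt_trans (correlation_weight_bound lf lh e0) _; rewrite ltry.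
have iZ : plane.-integrable setT (EFin \o (fun p : point =>
    N2 g * (poisson eps p.1 * (normc (f (p.2 + p.1)) * normc (h p.2))))).
  exact: (integrableZl measurableT (N2 g) iB).
apply: (Cintegrable_dom _ _ iZ).
  apply: CmeasM; first exact: Cmeas_real.
  apply: CmeasM; first by apply: CmeasM => //; exact: Cmeas_conj.
  exact: (Cmeas_comp m1 (Cmeas_conj (Cmeas_correlation lg lg))).
move=> p; rewrite normcMr normc_nneg// normcMr (normcMr (f _)) (normc_conj (h _)).
rewrite [X in _ <= X]mulrC -[X in _ <= X]mulrA ler_wpM2l//.
by rewrite ler_wpM2l ?conj_correlation_bounded// mulr_ge0 ?normc_ge0.
Qed.

Lemma lebesgue_value_conj_correlation g : L2 g ->
  lebesgue_value (fun tau => conjc (correlation g g tau)) (N2 g)%:C.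
Proof.
move=> lg; apply: continuous_lebesgue_value.
  exact/Cmeas_conj/Cmeas_correlation.
move=> delta d0; have [r r0 H] := correlation_continuous0 lg lg d0.
exists r => // tau tr; have := H _ tr; rewrite inner_self//.
by rewrite -[X in _ -> normc (_ - X) <= _]conjc_real -rmorphB normc_conj.
Qed.

(** Integrating out the frequency, then the translation, turns the damped
    pairing into a Poisson average of a product of correlations. *)
Lemma damped_moyal f g h eps : L2 f -> L2 g -> L2 h -> 0 < eps ->
  Cintegral plane (fun p => (damp eps p.2)%:C *
    (inner f (gabor_atom g p) * conjc (inner h (gabor_atom g p)))) =
  Cintegral mu (fun tau => (poisson eps tau)%:C *
    (correlation f h tau * conjc (correlation g g tau))).
Proof.
move=> lf lg lh e0.
have iD := Cintegrable_damped e0 (Cintegrable_gabor_product lf lg lh).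
have iT := Cintegrable_gabor_triple lf lg lh e0.
rewrite -plane_integral12//.
transitivity (Cintegral mu (fun u => Cintegral plane (fun p =>
    gabor_triple f g h eps (u, p)))).
  congr Cintegral; apply/funext => u.
  apply: (etrans _ (damped_fourier_pairing (Cintegrable_window u lf lg)
    (Cintegrable_window u lh lg) e0)).
  by congr Cintegral; apply/funext => eta; rewrite !inner_gabor_atom.
rewrite (Cintegral_swap (m1 := mu) (m2 := plane) iT).
have inner_u (p : point) : Cintegral mu (fun u => gabor_triple f g h eps (u, p)) =
    (poisson eps p.1)%:C * (f (p.2 + p.1) * conjc (h p.2) * conjc (correlation g g p.1)).
  rewrite -(window_correlation p.2 p.1 lg) [RHS]mulrA -CintegralZl.
    congr Cintegral; apply/funext => u; rewrite /gabor_triple/= conjcM conjcK.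
    by rewrite (addrC p.1); ring.
  apply: L2_Cintegrable_conj; first exact: L2_reflect.
  exact: L2_reflect.
under eq_fun do rewrite inner_u.
have iQ : Cintegrable plane (fun p : point => (poisson eps p.1)%:C *
    (f (p.2 + p.1) * conjc (h p.2) * conjc (correlation g g p.1))).
  exact: Cintegrable_weighted_correlation.
rewrite -plane_integral12//; congr Cintegral; apply/funext => tau /=.
have lft := L2_translate tau lf; have ifh := L2_Cintegrable_conj lft lh.
by rewrite /correlation/= CintegralZl ?CintegralZr//; exact: CintegrableZr.
Qed.

(** The orthogonality relation for Gabor coefficients: both sides are limits of
    the damped pairing, whose Poisson side concentrates the product of the two
    correlations at the origin. *)
Lemma moyal f g h : L2 f -> L2 g -> L2 h ->
  Cintegral plane (fun p =>
    inner f (gabor_atom g p) * conjc (inner h (gabor_atom g p))) =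
  (2 * pi)%:C * (inner f h * (N2 g)%:C).
Proof.
move=> lf lg lh.
have mfh := Cmeas_correlation lf lh; have mgg := Cmeas_conj (Cmeas_correlation lg lg).
have bq tau : normc (correlation f h tau * conjc (correlation g g tau)) <=
    (N2 f + N2 h) / 2 * N2 g.
  by rewrite normcMr ler_pM ?normc_ge0// ?correlation_bounded// conj_correlation_bounded.
apply: (undamped_Cintegral (w := fun p : point => p.2)
  (q := fun tau => correlation f h tau * conjc (correlation g g tau))).
- exact: measurable_snd.
- exact: Cintegrable_gabor_product.
- exact: CmeasM.
- by apply: (integrable_poisson1_bounded _ bq); exact: CmeasM.
- apply: (lebesgue_valueM mfh mgg (fun tau => conj_correlation_bounded tau lg)).
    by apply: continuous_lebesgue_value => //; exact: correlation_continuous0.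
  exact: lebesgue_value_conj_correlation.
- by move=> eps e0; exact: damped_moyal.
Qed.

Lemma poisson_L2_integrable f eps : L2 f -> 0 < eps ->
  mu.-integrable setT (EFin \o (fun t => poisson eps t * normc (f t))).
Proof.
move=> lf e0.
have iS := integrableD measurableT (integrableZl measurableT (2 / eps) (integrable_poisson e0))
  (L2_integrable lf).
have {}iS : mu.-integrable setT (EFin \o (fun t =>
   2 / eps * poisson eps t + normc (f t) ^+ 2)) by exact: iS.
apply: (le_integrable measurableT _ _ iS).
  apply/measurable_EFinP; apply: measurable_funM; first exact: measurable_poisson.
  exact/Cmeas_normc/L2_Cmeas.
have P0 t := poisson_ge0 t e0.
move=> t _ /=; rewrite lee_fin (ger0_norm (mulr_ge0 (P0 t) (normc_ge0 _))).
rewrite (le_trans _ (ler_norm _))// (le_trans (young_product _ _ ltr01))//.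
have h1 : poisson eps t ^+ 2 <= 2 / eps * poisson eps t.
  by rewrite expr2 ler_wpM2r// poisson_le.
have h2 := sqr_ge0 (normc (f t)); have h3 := sqr_ge0 (poisson eps t).
by rewrite invr1 !mul1r; move: (_ / eps * _) h1 => a;
  move: (normc _ ^+ 2) h2 => b; move: (poisson _ _ ^+ 2) h3 => c; lra.
Qed.

(** The analogue of [gabor_triple] when the second coefficient is replaced by
    the value of the atom at [y]; [z] holds the translation and the lag. *)
Definition point_triple f g eps y (z : point) : R[i] :=
  g (y - z.1) * (f (z.2 + y) * conjc (g (z.2 + y - z.1)) * (poisson eps z.2)%:C).

Lemma Cintegrable_point_triple f g eps y : L2 f -> L2 g -> 0 < eps ->
  Cintegrable plane (point_triple f g eps y).
Proof.
move=> lf lg e0; have mf := L2_Cmeas lf; have mg := L2_Cmeas lg.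
have m1 : measurable_fun setT (fun z : point => z.1) by exact: measurable_fst.
have m2 : measurable_fun setT (fun z : point => z.2) by exact: measurable_snd.
have P0 t := poisson_ge0 t e0.
have mPt : Cmeas (point_triple f g eps y).
  apply: CmeasM.
    by apply: (Cmeas_comp _ mg); exact: measurable_funB.
  apply: CmeasM; last first.
    by apply: Cmeas_real; exact: (measurableT_comp (measurable_poisson e0) m2).
  apply: CmeasM; first by apply: (Cmeas_comp _ mf); exact: measurable_funD.
  apply: Cmeas_conj; apply: (Cmeas_comp _ mg); apply: measurable_funB => //.
  exact: measurable_funD.
apply: Cintegrable_plane21 => //.
have iF := poisson_L2_integrable (L2_translate y lf) e0.
have iF' : mu.-integrable setT (EFin \o (fun t =>
   N2 g * (poisson eps t * normc (f (t + y))))).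
  exact: (integrableZl measurableT (N2 g) iF).
apply: le_lt_trans (integrable_nonneg_lty iF').
have mT : measurable_fun setT (fun tau => poisson eps tau * normc (f (tau + y))).
  by apply: measurable_funM; [exact: measurable_poisson|
    apply: Cmeas_normc; exact: (Cmeas_comp (measurable_shift y) mf)].
have E tau : (\int[mu]_u (normc (point_triple f g eps y (u, tau)))%:E =
   \int[mu]_u ((poisson eps tau * normc (f (tau + y))) *
     (normc (g (y - u)) * normc (g (y + tau - u))))%:E)%E.
  apply: eq_integral => u _; rewrite /point_triple/= !normcMr normc_conj normc_nneg//.
  by rewrite (addrC y tau); congr EFin; ring.
have mg2 tau : measurable_fun setT (fun u => normc (g (y - u)) * normc (g (y + tau - u))).
  apply: measurable_funM; apply: Cmeas_normc.
    exact: (Cmeas_comp (measurable_reflect y) mg).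
  exact: (Cmeas_comp (measurable_reflect (y + tau)) mg).
have T0 tau : 0 <= poisson eps tau * normc (f (tau + y)) by rewrite mulr_ge0 ?normc_ge0.
have E2 tau : (\int[mu]_u (normc (point_triple f g eps y (u, tau)))%:E <=
   (N2 g * (poisson eps tau * normc (f (tau + y))))%:E)%E.
  rewrite E integral_scaleE; [|exact: mg2|exact: T0|by move=> u; rewrite mulr_ge0 ?normc_ge0].
  rewrite [X in (_ <= X%:E)%E]mulrC (EFinM (poisson eps tau * _)).
  by apply: lee_wpmul2l; [rewrite lee_fin|exact: window_correlation_bound].
apply: ge0_le_integral => //.
- by move=> tau _; apply: integral_ge0 => u _; rewrite lee_fin normc_ge0.
- apply: (measurable_fun_fubini_tonelli_G (m1 := mu)
    (EFin \o fun z => normc (point_triple f g eps y z))).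
    by apply/measurable_EFinP; exact: Cmeas_normc.
  by move=> p; rewrite lee_fin normc_ge0.
- by apply/measurable_EFinP; apply: measurable_funM => //; exact: mT.
Qed.

Lemma Cintegrable_damped_fourier k eps y : Cintegrable mu k -> 0 < eps ->
  Cintegrable mu (fun eta => (damp eps eta)%:C * (fourier k eta * expi (eta * y))).
Proof.
move=> ik e0; pose C := \int[mu]_t normc (k t).
have iC : mu.-integrable setT (EFin \o (fun eta => C * damp eps eta)).
  exact: (integrableZl measurableT C (integrable_damp e0)).
apply: (Cintegrable_dom _ _ iC).
  apply: CmeasM; first by apply: Cmeas_real; exact: measurable_damp.
  apply: CmeasM; last exact: measurable_expi.
  by apply: Cmeas_fourier; exact: Cintegrable_meas ik.
move=> eta; rewrite !normcMr normc_expi mulr1 normc_nneg ?damp_ge0// mulrC.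
by rewrite ler_wpM2r ?damp_ge0// fourier_bounded.
Qed.

Lemma Cintegrable_poisson_mul k eps : Cintegrable mu k -> 0 < eps ->
  Cintegrable mu (fun t => k t * (poisson eps t)%:C).
Proof.
move=> ik e0.
have iC : mu.-integrable setT (EFin \o (fun t => 2 / eps * normc (k t))).
  exact: (integrableZl measurableT (2 / eps) (Cintegrable_normc ik)).
apply: (Cintegrable_dom _ _ iC).
  apply: CmeasM; first exact: (Cintegrable_meas ik).
  by apply: Cmeas_real; exact: measurable_poisson.
move=> t; rewrite normcMr mulrC normc_nneg ?poisson_ge0//.
by rewrite ler_wpM2r ?normc_ge0// poisson_le.
Qed.

(** For fixed [u] the transform of [f conj(T_u g)] is inverted at [y] through
    its damped integral. *)
Lemma damped_point_identity f g eps y : L2 f -> L2 g -> 0 < eps ->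
  Cintegrable plane (fun p => inner f (gabor_atom g p) * gabor_atom g p y) ->
  Cintegral plane (fun p => (damp eps p.2)%:C *
    (inner f (gabor_atom g p) * gabor_atom g p y)) =
  Cintegral mu (fun tau => (poisson eps tau)%:C *
    (f (tau + y) * conjc (correlation g g tau))).
Proof.
move=> lf lg e0 iD0; have iD := Cintegrable_damped e0 iD0.
have iT := Cintegrable_point_triple y lf lg e0.
rewrite -plane_integral12//.
transitivity (Cintegral mu (fun u => Cintegral mu (fun tau =>
    point_triple f g eps y (u, tau)))).
  congr Cintegral; apply/funext => u.
  have iw := Cintegrable_window u lf lg.
  transitivity (g (y - u) * Cintegral mu (fun eta => (damp eps eta)%:C *
      (fourier (fun t => f t * conjc (g (t - u))) eta * expi (eta * y)))).
    rewrite -CintegralZl; last exact: Cintegrable_damped_fourier.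
    congr Cintegral; apply/funext => eta; rewrite inner_gabor_atom.
    by rewrite /gabor_atom /modulation /translation; ring.
  rewrite damped_fourier_inversion// -CintegralZl//.
  exact: Cintegrable_poisson_mul (Cintegrable_shift y iw) e0.
rewrite plane_integral12// -plane_integral21//; congr Cintegral; apply/funext => tau.
rewrite -(window_correlation y tau lg) mulrA -CintegralZl.
  congr Cintegral; apply/funext => u; rewrite /point_triple/=.
  by rewrite (addrC tau y); ring.
by apply: L2_Cintegrable_conj; exact: L2_reflect.
Qed.

(** Inversion at a single point: only [f] needs a Lebesgue point there, because
    averaging over the window has already replaced the product of two windows
    by its continuous autocorrelation. *)
Lemma gabor_inversion_at f g y (c : R[i]) : L2 f -> L2 g ->
  lebesgue_value (fun tau => f (tau + y) * conjc (correlation g g tau)) c ->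
  Cintegrable plane (fun p => inner f (gabor_atom g p) * gabor_atom g p y) ->
  Cintegral plane (fun p => inner f (gabor_atom g p) * gabor_atom g p y) =
  (2 * pi)%:C * c.
Proof.
move=> lf lg Lq iD.
have lq : L2 (fun tau => f (tau + y) * conjc (correlation g g tau)).
  under eq_fun do rewrite mulrC.
  apply: (L2_mul_bounded (C := N2 g)); last exact: L2_translate.
    exact/Cmeas_conj/Cmeas_correlation.
  by move=> tau; exact: conj_correlation_bounded.
apply: (undamped_Cintegral (w := fun p : point => p.2) _ iD _ _ Lq).
- exact: measurable_snd.
- exact: L2_Cmeas.
- exact: poisson_L2_integrable.
- by move=> eps e0; exact: damped_point_identity.
Qed.

End GaborIdentities.

(** * The superoscillating sequence *)

Section Superoscillation.
Context {R : realType}.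
Local Notation mu := (@lebesgue_measure R).
Local Notation "z %:C" := (real_complex R z).
Local Notation N2 f := (\int[mu]_t normc (f t) ^+ 2).
Local Notation I_ r := (\1_(ball (0 : R) r) : R -> R).
Implicit Types (f g h F : R -> R[i]) (a x y t w : R) (n j : nat).

Definition normc_continuous_at F y := forall delta, 0 < delta ->
  exists2 r, 0 < r & forall tau, `|tau| <= r -> normc (F (tau + y) - F y) <= delta.

Lemma real_continuous_at (phi : R -> R) y : {for y, continuous phi} ->
  forall delta, 0 < delta -> exists2 r, 0 < r & forall tau, `|tau| <= r ->
    `|phi (tau + y) - phi y| <= delta.
Proof.
move=> cphi delta d0.
have /cvgrPdist_le/(_ _ d0)/nbhs_ballP[e /= e0 He] := cphi.
exists (e / 2); first by rewrite divr_gt0.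
move=> tau taue; rewrite distrC; apply: He; rewrite /ball/= opprD addrCA subrr addr0 normrN.
by rewrite (le_lt_trans taue)// ltr_pdivrMr// ltr_pMr// ltr1n.
Qed.

Lemma continuous_at_expi w y : normc_continuous_at (fun t => expi (w * t)) y.
Proof.
move=> delta d0; have d2 : 0 < delta / 2 by rewrite divr_gt0.
have cw : continuous (fun t : R => w * t).
  by move=> t; apply: continuousM; [exact: cst_continuous|exact: cvg_id].
have cc : {for y, continuous (fun t => cos (w * t))}.
  by apply: continuous_comp; [exact: cw|exact: continuous_cos].
have cs : {for y, continuous (fun t => sin (w * t))}.
  by apply: continuous_comp; [exact: cw|exact: continuous_sin].
have [r1 r10 H1] := real_continuous_at cc d2.
have [r2 r20 H2] := real_continuous_at cs d2.
exists (Num.min r1 r2); first by rewrite lt_min r10.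
move=> tau; rewrite le_min => /andP[t1 t2].
rewrite (le_trans (normc_le_ReIm _))// [delta]splitr.
by rewrite Re_addc Im_addc Re_oppc Im_oppc lerD ?H1 ?H2.
Qed.

Lemma normc_continuous_at_D F h y : normc_continuous_at F y -> normc_continuous_at h y ->
  normc_continuous_at (fun t => F t + h t) y.
Proof.
move=> cF ch delta d0; have d2 : 0 < delta / 2 by rewrite divr_gt0.
have [r1 r10 H1] := cF _ d2; have [r2 r20 H2] := ch _ d2.
exists (Num.min r1 r2); first by rewrite lt_min r10.
move=> tau; rewrite le_min => /andP[t1 t2].
rewrite opprD addrACA (le_trans (le_normc_add _ _))// [delta]splitr.
by rewrite lerD ?H1 ?H2.
Qed.

Lemma normc_continuous_at_Z (c : R[i]) F y : normc_continuous_at F y ->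
  normc_continuous_at (fun t => c * F t) y.
Proof.
move=> cF delta d0; have c1 : 0 < normc c + 1 by rewrite ltr_wpDl// normc_ge0.
have [r r0 H] := cF _ (divr_gt0 d0 c1).
exists r => // tau tr; rewrite -mulrBr normcMr.
apply: (@le_trans _ _ ((normc c + 1) * (delta / (normc c + 1)))).
  by apply: ler_pM; rewrite ?normc_ge0 ?lerDl// H.
by rewrite mulrC divfK// gt_eqF.
Qed.

Lemma normc_continuous_at_sum (I : Type) (s : seq I) (F : I -> R -> R[i]) y :
  (forall i, normc_continuous_at (F i) y) ->
  normc_continuous_at (fun t => \sum_(i <- s) F i t) y.
Proof.
move=> cF; elim: s => [|i s IH].
  rewrite (_ : (fun t => _) = fun _ : R => 0); last first.
    by apply/funext => t; rewrite big_nil.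
  move=> delta d0; exists 1 => // tau _.
  by rewrite subrr (_ : normc 0 = 0) ?ltW// normcE2/= expr0n/= addr0 sqrtr0.
rewrite (_ : (fun t => _) = fun t : R => F i t + \sum_(i <- s) F i t); last first.
  by apply/funext => t; rewrite big_cons.
by apply: normc_continuous_at_D.
Qed.

Lemma superosc_continuous n a y : normc_continuous_at (fun t => superosc n t a) y.
Proof.
by apply: normc_continuous_at_sum => j; apply: normc_continuous_at_Z; exact: continuous_at_expi.
Qed.

Lemma Cmeas_superosc n a : Cmeas (fun t => superosc n t a).
Proof.
apply: Cmeas_sum => j.
apply: CmeasM; first exact: Cmeas_cst.
by apply: Cmeas_expi_comp; exact: measurable_scale.
Qed.

Lemma superosc_bounded n a : exists C, forall t, normc (superosc n t a) <= C.
Proof.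
exists (\sum_(j < n.+1) `|Defs.coefC n a j|) => t.
rewrite /superosc; elim/big_rec2: _ => [|j z C _ zC].
  by rewrite normcE2/= expr0n/= addr0 sqrtr0.
rewrite (le_trans (le_normc_add _ _))// lerD//.
by rewrite normcMr normc_expi mulr1 normc_real.
Qed.

(** The function whose Gabor coefficients are [phi]. *)
Definition superosc_window n a x g : R -> R[i] := fun t => superosc n t a * g (t - x).

Lemma L2_superosc_window n a x g : L2 g -> L2 (superosc_window n a x g).
Proof.
move=> lg; have [C SC] := superosc_bounded n a.
apply: (L2_mul_bounded (Cmeas_superosc n a) SC).
exact: (L2_translate (- x) lg).
Qed.

Lemma phi_inner n a x g p : L2 g ->
  phi n a x g p = inner (superosc_window n a x g) (gabor_atom g p).
Proof.
move=> lg; case: p => u eta.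
have ij j : Cintegrable mu (fun t => (Defs.coefC n a j)%:C *
    (gabor_atom g (x, freq n j) t * conjc (gabor_atom g (u, eta) t))).
  by apply: CintegrableZl; apply: L2_Cintegrable_conj; exact: L2_gabor_atom.
transitivity (Cintegral mu (fun t => \sum_(j < n.+1) (Defs.coefC n a j)%:C *
    (gabor_atom g (x, freq n j) t * conjc (gabor_atom g (u, eta) t)))).
  rewrite Cintegral_sum//; apply: eq_bigr => j _; rewrite CintegralZl//.
  by apply: L2_Cintegrable_conj; exact: L2_gabor_atom.
congr Cintegral; apply/funext => t; rewrite /superosc_window /superosc !mulr_suml.
apply: eq_bigr => j _; rewrite mulrA; congr (_ * _).
by rewrite /gabor_atom /modulation /translation/= mulrA.
Qed.

Lemma L2_N2_eq0 h : L2 h -> N2 h = 0 -> {ae mu, forall t, h t = 0}.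
Proof.
move=> lh h0.
have mh : measurable_fun setT (EFin \o (fun t => normc (h t) ^+ 2)).
  exact: (measurable_int _ (L2_integrable lh)).
have I0 : (\int[mu]_t `|(EFin \o (fun t => normc (h t) ^+ 2)%R) t| = 0)%E.
  under eq_integral do rewrite /= ger0_norm ?sqr_ge0//.
  by rewrite -Rintegral_EFin ?h0//; exact: L2_integrable.
have := (ae_eq_integral_abs mu measurableT mh).1 I0; apply: filterS => t /= /(_ I) [] /eqP.
by rewrite sqrf_eq0 => /eqP/normc_eq0P.
Qed.

Lemma N2_neq0 g : L2 g -> ~ {ae mu, forall t, g t = 0} -> N2 g != 0.
Proof. by move=> lg gn0; apply/eqP => /(L2_N2_eq0 lg). Qed.

Lemma real_lebesgue_pt_averages (phi : R -> R) y : measurable_fun setT phi ->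
  lebesgue_pt phi y ->
  forall delta, 0 < delta -> exists2 r0, 0 < r0 & forall r, 0 < r <= r0 ->
    (\int[mu]_t (`|phi (t + y) - phi y| * I_ r t)%:E <= (delta * r)%:E)%E.
Proof.
move=> mphi Lphi delta d0; have d2 : 0 < delta / 2 by rewrite divr_gt0.
have /fine_cvgP[Hfin Hcv] := Lphi.
have Hlt : \forall r \near (0:R)^'+, fine (davg phi y r) < delta / 2.
  exact: (cvgr_lt _ Hcv _ d2).
have /nbhs_ballP[e /= e0 He] : \forall r \near (0:R)^'+,
    davg phi y r \is a fin_num /\ fine (davg phi y r) < delta / 2.
  by near do split.
exists (e / 2); first by rewrite divr_gt0.
move=> r /andP[r0 re].
have [|] := He r _ r0.
  rewrite /ball/= sub0r normrN gtr0_norm// (le_lt_trans re)//.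
  by rewrite ltr_pdivrMr// ltr_pMr// ltr1n.
move=> dfin dlt.
have {dlt} : (davg phi y r <= (delta / 2)%:E)%E.
  by rewrite -[X in (X <= _)%E]fineK// lee_fin ltW.
rewrite /davg /iavg.
have muB : mu (ball y r) = (r *+ 2)%:E := lebesgue_measure_ball y (ltW r0).
rewrite muB inver mulrn_eq0/= gt_eqF// lee_pdivrMl ?mulrn_wgt0//.
rewrite -EFinM.
have -> : r *+ 2 * (delta / 2) = delta * r by rewrite -mulr_natr; field.
apply: le_trans; rewrite le_eqVlt; apply/orP; left; apply/eqP.
have mI : measurable_fun setT (\1_(ball y r) : R -> R).
  by apply: measurable_indic; exact: measurable_ball.
have mF : measurable_fun setT (fun t : R => `|phi t - phi y| * \1_(ball y r) t).
  apply: measurable_funM => //; apply: measurableT_comp => //.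
  by apply: measurable_funB.
transitivity (\int[mu]_t (`|phi t - phi y| * \1_(ball y r) t)%:E)%E.
  rewrite -[RHS](ge0_integral_shift y).
  - apply: eq_integral => t _; rewrite !indicE; congr (_ * _)%:E.
    congr (nat_of_bool _)%:R; apply/idP/idP; rewrite !inE /ball/=.
      by rewrite sub0r normrN opprD addrCA subrr addr0 normrN.
    by rewrite sub0r normrN opprD addrCA subrr addr0 normrN.
  - exact/measurable_EFinP.
  - by move=> t; rewrite lee_fin mulr_ge0.
rewrite [RHS]integral_mkcond; apply: eq_integral => t _.
rewrite /patch indicE; case: ifP => _ /=; first by rewrite mulr1.
by rewrite mulr0.
Unshelve. all: by end_near. Qed.

Lemma Clebesgue_pt_value g y : Cmeas g -> Clebesgue_pt g y ->
  lebesgue_value (fun tau => g (tau + y)) (g y).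
Proof.
move=> [mg1 mg2] [L1 L2'] delta d0; have d2 : 0 < delta / 2 by rewrite divr_gt0.
have [r1 r10 H1] := real_lebesgue_pt_averages mg1 L1 d2.
have [r2 r20 H2] := real_lebesgue_pt_averages mg2 L2' d2.
exists (Num.min r1 r2); first by rewrite lt_min r10.
move=> r /andP[r0]; rewrite le_min => /andP[rr1 rr2].
have b1 := H1 r; rewrite r0 rr1 in b1; have {b1} b1 := b1 isT.
have b2 := H2 r; rewrite r0 rr2 in b2; have {b2} b2 := b2 isT.
rewrite [delta]splitr mulrDl EFinD.
have mI := measurable_ball_indic r.
have m1 : measurable_fun setT (fun t => `|complex.Re (g (t + y)) - complex.Re (g y)| * I_ r t).
  apply: measurable_funM => //; apply: measurableT_comp => //.
  by apply: measurable_funB => //; exact: (measurable_translate y mg1).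
have m2 : measurable_fun setT (fun t => `|complex.Im (g (t + y)) - complex.Im (g y)| * I_ r t).
  apply: measurable_funM => //; apply: measurableT_comp => //.
  by apply: measurable_funB => //; exact: (measurable_translate y mg2).
apply: le_trans (leeD b1 b2).
rewrite -integral_addE; last 4 first.
- exact: m1.
- exact: m2.
- by move=> t; rewrite mulr_ge0.
- by move=> t; rewrite mulr_ge0.
apply: integral_leE.
- apply: measurable_funM => //; apply: Cmeas_normc; apply: CmeasB.
    by apply: (Cmeas_comp (measurable_shift y)); split.
  exact: Cmeas_cst.
- by apply: measurable_funD; [exact: m1|exact: m2].
- by move=> t; rewrite mulr_ge0// normc_ge0.
move=> t; rewrite -mulrDl ler_wpM2r//.
by rewrite (le_trans (normc_le_ReIm _))// Re_addc Im_addc Re_oppc Im_oppc.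
Qed.

(** Only [g] is merely Lebesgue-continuous at the point; the other two factors
    are bounded and continuous there. *)
Lemma superosc_window_lebesgue_value n a x g y : L2 g -> Clebesgue_pt g (y - x) ->
  lebesgue_value (fun tau => superosc_window n a x g (tau + y) * conjc (correlation g g tau))
    (g (y - x) * superosc n y a * (N2 g)%:C).
Proof.
move=> lg Lg; have mg := L2_Cmeas lg; have [C SC] := superosc_bounded n a.
have mS : Cmeas (fun tau : R => superosc n (tau + y) a).
  exact: (Cmeas_comp (measurable_shift y) (Cmeas_superosc n a)).
have LS : lebesgue_value (fun tau => superosc n (tau + y) a) (superosc n y a).
  by apply: continuous_lebesgue_value => //; exact: superosc_continuous.
have mgs : Cmeas (fun tau : R => g (tau + (y - x))).
  exact: (Cmeas_comp (measurable_shift (y - x)) mg).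
have LgS := lebesgue_valueM mgs mS (fun tau => SC (tau + y)) (Clebesgue_pt_value mg Lg) LS.
have := lebesgue_valueM (CmeasM mgs mS) (Cmeas_conj (Cmeas_correlation lg lg))
  (fun tau => conj_correlation_bounded tau lg) LgS (lebesgue_value_conj_correlation lg).
rewrite (_ : (fun t => _) = (fun tau =>
  superosc_window n a x g (tau + y) * conjc (correlation g g tau)))//.
by apply/funext => tau; rewrite /superosc_window addrA [in RHS](mulrC (superosc _ _ _)).
Qed.

(** The orthogonality relation read as a statement about the functional
    [h |-> <f, h>]. *)
Lemma gabor_weak_integral n a x g : L2 g ->
  is_weak_integral (phi n a x g) (gabor_atom g)
    (fun t => (2 * pi * N2 g)%:C * superosc_window n a x g t).
Proof.
move=> lg; have lG := L2_superosc_window n a x lg.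
split=> [|h lh]; first exact: L2Z.
have E : (fun p => phi n a x g p * inner (gabor_atom g p) h) =
    (fun p => inner (superosc_window n a x g) (gabor_atom g p) * conjc (inner h (gabor_atom g p))).
  apply/funext => p; rewrite phi_inner// inner_conj//; exact: L2_gabor_atom.
rewrite E; split; first exact: Cintegrable_gabor_product.
rewrite [LHS](moyal lG lg lh).
rewrite {2}/inner.
under [in RHS]eq_fun do rewrite -mulrA.
rewrite CintegralZl; last exact: L2_Cintegrable_conj.
by rewrite [in RHS]rmorphM /inner; ring.
Qed.

(** Test the two weak integrals against their difference. *)
Lemma weak_integral_unique (v : R * R -> R[i]) (w : R * R -> R -> R[i]) Phi Psi :
  is_weak_integral v w Phi -> is_weak_integral v w Psi ->
  {ae mu, forall t, Phi t = Psi t}.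
Proof.
move=> [lPhi HPhi] [lPsi HPsi].
have lD := L2B lPhi lPsi.
have D0 : inner (fun t => Phi t - Psi t) (fun t => Phi t - Psi t) = 0.
  rewrite {1}/inner; under eq_fun do rewrite mulrBl.
  rewrite CintegralB; [|exact: L2_Cintegrable_conj|exact: L2_Cintegrable_conj].
  rewrite -[X in X - _](HPhi _ lD).2 -[X in _ - X](HPsi _ lD).2.
  by rewrite subrr.
have H : {ae mu, forall t, Phi t - Psi t = 0}.
  apply: L2_N2_eq0 => //; move: D0; rewrite inner_self// => -[].
  by [].
apply: (@filterS _ _ (ae_filter_ringOfSetsType mu) _ _ _ H) => t /eqP.
by rewrite subr_eq0 => /eqP.
Qed.

End Superoscillation.

(* The factor 2 pi comes from the characters expi (w * t), which are used with
   the unnormalised measure du deta. *)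
Theorem theorem3p7 (R : realType) (a x : R) (g : R -> R[i]) (n : nat)
    (ha : 1 < a)
    (gL2 : L2 g)
    (g_neq0 : ~ {ae (@lebesgue_measure R), forall t, g t = 0})
    (n_gt0 : (0 < n)%N) :
  (* pointwise form, wherever the integral and the value of g make sense *)
  (forall y : R,
     Clebesgue_pt g (y - x) ->
     Cintegrable mu2 (fun p => phi n a x g p * gabor_atom g p y) ->
     g (y - x) != 0 ->
     superosc n y a =
       1 / (real_complex R (2 * pi) * g (y - x) * real_complex R (L2norm g ^+ 2))
       * Cintegral mu2 (fun p => phi n a x g p * gabor_atom g p y))
  /\
  (* the integral over the plane as an element of L^2(R), for every window *)
  (exists Phi, is_weak_integral (phi n a x g) (gabor_atom g) Phi)
  /\
  (forall Phi, is_weak_integral (phi n a x g) (gabor_atom g) Phi ->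
     {ae (@lebesgue_measure R), forall y : R,
        g (y - x) != 0 ->
        superosc n y a =
          1 / (real_complex R (2 * pi) * g (y - x)
               * real_complex R (L2norm g ^+ 2))
          * Phi y}).
Proof.
have lG := L2_superosc_window n a x gL2.
have pi0 : real_complex R (2 * pi) != 0.
  by rewrite eq_complex/= eqxx andbT mulf_neq0 ?pnatr_eq0// gt_eqF// pi_gt0.
set N := L2norm g ^+ 2.
have NE : N = \int[@lebesgue_measure R]_t normc (g t) ^+ 2 by exact: L2norm_sqr.
have N0 : real_complex R N != 0.
  by rewrite eq_complex/= eqxx andbT NE; exact: N2_neq0.
split=> [y Lg iD gy|].
  have E : (fun p => phi n a x g p * gabor_atom g p y) =
      (fun p => inner (superosc_window n a x g) (gabor_atom g p) * gabor_atom g p y).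
    by apply/funext => p; rewrite phi_inner.
  rewrite E in iD *.
  have -> : Cintegral mu2 (fun p => inner (superosc_window n a x g) (gabor_atom g p) *
      gabor_atom g p y) = real_complex R (2 * pi) *
      (g (y - x) * superosc n y a * real_complex R N).
    rewrite NE; apply: (gabor_inversion_at lG gL2 _ iD).
    exact: superosc_window_lebesgue_value.
  move: (real_complex R (2 * pi)) pi0 (real_complex R N) N0 => P P0 M M0.
  by field; rewrite P0 gy M0.
split; first by eexists; exact: gabor_weak_integral.
move=> Phi wPhi.
have H := weak_integral_unique wPhi (gabor_weak_integral n a x gL2).
apply: (@filterS _ _ (ae_filter_ringOfSetsType (@lebesgue_measure R)) _ _ _ H).
move=> y -> gy; rewrite -NE /superosc_window.
have -> : real_complex R (2 * pi * N) = real_complex R (2 * pi) * real_complex R N.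
  by rewrite rmorphM.
move: (real_complex R (2 * pi)) pi0 (real_complex R N) N0 => P P0 M M0.
by field; rewrite P0 gy M0.
Qed.
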